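(* Let $\phi:\mathbb{R}^n\to\mathbb{R}$ be twice continuously differentiable with $L_2$-Lipschitz Hessian, and bounded below on $\mathbb{R}^n$ by a scalar $\hat\phi$. Run Algorithm 2 (described in the context) with the subexponential-noise zeroth-order oracle with constants $\epsilon_f\ge0$, $a>0$, with the first- and second-order oracles with constants $\epsilon_g,\kappa_{\rm eg},\epsilon_H,\kappa_{\rm eh}\ge0$ and reliabilities $p_1,p_2\in[1/2,1]$, with $\|H_k\|\le\kappa_{\rm bhm}$ for all $k$, and with $r\ge2\epsilon_f+\epsilon_g^{3/2}$. Assume the problem is scaled so that the desired accuracy satisfies $\epsilon'\le1$ and $\epsilon_g,\epsilon_H\ll1$ (in particular $\epsilon_g,\epsilon_H\le 1$). Let $p_{12}=p_1p_2$ and $p_0=1-2\exp\big(\frac a2(2\epsilon_f+\epsilon_g^{3/2}-r)\big)$. Let $C_8$ and the optimality measure $\beta$ be as defined in the context. Given $$\epsilon'>\sqrt[3]{\frac{4\epsilon_f+8/a+2r}{C_8\gamma^3(2p_0+2p_{12}-3)}},$$ the iterates satisfy $$\mathbb{P}\Big\{\min_{0\le k\le T-1}\beta(X_k)\le\epsilon'\Big\}\ge1-\exp\Big(-\frac{(1-\hat p_{12}/p_{12})^2}{2}T\Big)-\exp\Big(-\frac{(1-\hat p_0/p_0)^2}{2}T\Big)-\exp\Big(-\frac a4t\Big)$$ for any $\hat p_0$ and $\hat p_{12}$ such that $\hat p_0+\hat p_{12}\in\Big(\frac32+\frac{2\epsilon_f+4/a+r}{C_8(\gamma\epsilon')^3},\,p_0+p_{12}\Big]$,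 any $t\ge0$, and any positive integer $$T\ge\Big(\hat p_0+\hat p_{12}-\frac32-\frac{2\epsilon_f+4/a+r}{C_8(\gamma\epsilon')^3}\Big)^{-1}\Big[\frac{\phi(x_0)-\hat\phi+t}{C_8(\gamma\epsilon')^3}+\frac12\log_\gamma\Big(\min\Big\{\frac{\epsilon'}{\delta_0},\frac{\delta_0}{\beta(x_0)}\Big\}\Big)+\frac12\Big].$$
   Context: Notation: $\|\cdot\|$ is the Euclidean norm of vectors and the spectral norm of matrices; $\langle\cdot,\cdot\rangle$ is the sum of entrywise products; $\lambda_{\min}$ is the smallest eigenvalue of a symmetric matrix; $\log_\gamma$ is the logarithm to base $\gamma\in(0,1)$. Subexponential-noise zeroth-order oracle: given $x$ it returns a random value $f(x,\xi^{(0)})$ whose error $e(x,\xi^{(0)})=f(x,\xi^{(0)})-\phi(x)$ satisfies $\mathbb{P}_{\xi^{(0)}}\{|e(x,\xi^{(0)})|>t\}\le\exp(a(\epsilon_f-t))$ for all $t\ge0$. First-order oracle: given $\delta^{(1)}>0$, $p_1\in[1/2,1]$, $x\in\mathbb{R}^n$, it returns a random vector $g(x,\xi^{(1)})$ with $\mathbb{P}\{\|g(x,\xi^{(1)})-\nabla\phi(x)\|\le\epsilon_g+\kappa_{\rm eg}\delta^{(1)}\}\ge p_1$. Second-order oracle: given $\delta^{(2)}>0$, $p_2\in[1/2,1]$, $x\in\mathbb{R}^n$, it returns a random symmetric matrix $H(x,\xi^{(2)})$ with $\mathbb{P}\{\|H(x,\xi^{(2)})-\nabla^2\phi(x)\|\le\epsilon_H+\kappa_{\rm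 eh}\delta^{(2)}\}\ge p_2$. The constants $\epsilon_g,\kappa_{\rm eg},\epsilon_H,\kappa_{\rm eh}\ge0$ are intrinsic to the oracles. Algorithm 2. Inputs: $x_0\in\mathbb{R}^n$, $\delta_0>0$, $\eta_1>0$, $\eta_2>0$, $\gamma\in(0,1)$, $r>0$, $p_1,p_2$; constants $\kappa_{\rm fod}\in(0,1]$, $\kappa_{\rm bhm}>0$. For $k=0,1,2,\dots$: (1) Obtain $g_k$ from the first-order oracle with input $(\delta_k^2,p_1,x_k)$ and $H_k$ from the second-order oracle with input $(\delta_k,p_2,x_k)$; put $m_k(x_k+s)=\phi(x_k)+\langle g_k,s\rangle+\frac12\langle H_ks,s\rangle$. (2) Compute $s_k$ with $\|s_k\|\le\delta_k$ and $m_k(x_k)-m_k(x_k+s_k)\ge\frac{\kappa_{\rm fod}}{2}\max\{\|g_k\|\min\{\|g_k\|/\|H_k\|,\delta_k\},\,-\lambda_{\min}(H_k)\delta_k^2\}$ (with $\|g_k\|/\|H_k\|=+\infty$ if $H_k=0$). (3) Obtain $f_k$ and $f_k^+$ from the zeroth-order oracle at $x_k$ and $x_k+s_k$, and set $\rho_k=\frac{f_k-f_k^++r}{m_k(x_k)-m_k(x_k+s_k)}$. (4) Let $\beta_k^m=\max\{\|g_k\|,-\lambda_{\min}(H_k)\}$. If $\rho_k\ge\eta_1$: set $x_{k+1}=x_k+s_k$ and $\delta_{k+1}=\gamma^{-1}\delta_k$ if $\beta_k^m\ge\eta_2\delta_k$, $\delta_{k+1}=\gamma\delta_k$ if $\beta_k^m<\eta_2\delta_k$.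 Otherwise set $x_{k+1}=x_k$, $\delta_{k+1}=\gamma\delta_k$. If $m_k(x_k)=m_k(x_k+s_k)$, the step is rejected (treated as $\rho_k<\eta_1$). Stochastic process: $X_k,X_k^+,\Delta_k$ denote the random quantities with realizations $x_k,x_k+s_k,\delta_k$. Let $\mathcal{F}_{k-1}$ be the $\sigma$-algebra generated by all oracle randomness in iterations $0,\dots,k-1$, and $\mathcal{F}'_{k-1}$ the one generated additionally by the gradient and Hessian oracle randomness of iteration $k$ (so $X_k,\Delta_k$ are $\mathcal{F}_{k-1}$-measurable and $X_k^+$ is $\mathcal{F}'_{k-1}$-measurable). The oracle guarantees hold conditionally on the past: conditionally on $\mathcal{F}_{k-1}$, the event that both $\|H_k-\nabla^2\phi(X_k)\|\le\kappa_{\rm eh}\Delta_k+\epsilon_H$ and $\|g_k-\nabla\phi(X_k)\|\le\kappa_{\rm eg}\Delta_k^2+\epsilon_g$ hold has probability at least $p_{12}=p_1p_2$; and the absolute errors $\mathcal{E}_k$, $\mathcal{E}_k^+$ (realizations $|f_k-\phi(x_k)|$, $|f_k^+-\phi(x_k+s_k)|$) each satisfy $\mathbb{P}\{\mathcal{E}>t\mid\mathcal{F}'_{k-1}\}\le\exp(a(\epsilon_f-t))$ for all $t\ge0$. Optimality measure: $\beta(x)=\max\{C_4\|\nabla\phi(x)\|-C_5\epsilon_g,\ -C_6\lambda_{\min}(\nabla^2\phi(x))-C_7\epsilon_H\}$, where, with $D=L_2/3+2\kappa_{\rm eg}+\kappa_{\rm eh}$, the positive constants $C_4,\dots,C_7$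 are $$C_4=\min\Big\{\tfrac{1}{\kappa_{\rm bhm}+\kappa_{\rm eg}},\tfrac{(1-\eta_1)\kappa_{\rm fod}}{D+3+(1-\eta_1)\kappa_{\rm fod}\kappa_{\rm eg}},\tfrac{1}{\kappa_{\rm eg}+\eta_2}\Big\},\quad C_5=\max\Big\{\tfrac{1}{\kappa_{\rm bhm}+\kappa_{\rm eg}},\tfrac{(1-\eta_1)\kappa_{\rm fod}}{D+3+(1-\eta_1)\kappa_{\rm fod}\kappa_{\rm eg}},\tfrac{1}{\kappa_{\rm eg}+\eta_2}\Big\},$$ $$C_6=\min\Big\{\tfrac{(1-\eta_1)\kappa_{\rm fod}}{D+2+(1-\eta_1)\kappa_{\rm fod}\kappa_{\rm eh}},\tfrac{1}{\kappa_{\rm eh}+\eta_2}\Big\},\quad C_7=\max\Big\{\tfrac{(1-\eta_1)\kappa_{\rm fod}+1}{D+2+(1-\eta_1)\kappa_{\rm fod}\kappa_{\rm eh}},\tfrac{1}{\kappa_{\rm eh}+\eta_2}\Big\}.$$ Also $C_8=\frac{\eta_1\eta_2\kappa_{\rm fod}}{2}\min\{\eta_2/\kappa_{\rm bhm},1\}$.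
   Formalization: The formal theorem also requires p̂₀ ≤ p₀ and p̂₁₂ ≤ p₁₂ separately (with only the sum constrained the bound is false, e.g. p̂₀ = p₀+c, p̂₁₂ = p₁₂−c, c large) and η₁ < 1, as the positivity of C₄,…,C₇ intends. *)

(* Defs.v *)
(* Points of R^n are row vectors, as in the library's
   'J f x, and matrices act on them from the right; every matrix below that
   stands for an operator is symmetric. *)
From HB Require Import structures.
From mathcomp Require Import all_boot all_order all_algebra.
From mathcomp Require Import all_classical all_reals all_analysis.
Import Order.TTheory GRing.Theory Num.Theory numFieldNormedType.Exports.

Set Implicit Arguments.
Unset Strict Implicit.
Unset Printing Implicit Defensive.

Local Open Scope classical_set_scope.
Local Open Scope ring_scope.

Section Euclidean.
Context {R : realType} {n : nat}.
Implicit Types (u v x : 'rV[R]_n) (A : 'M[R]_n) (phi : 'rV[R]_n -> R).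

Definition dotv u v : R := \sum_(i < n) u 0 i * v 0 i.

(* The library's norm on matrices is the max norm. *)
Definition enorm v : R := Num.sqrt (dotv v v).

Definition spec_norm A : R := sup [set enorm (v *m A) | v in [set v | enorm v <= 1]].

(* For symmetric A and 0 < n the set of eigenvalues is finite and nonempty,
   so that the infimum is attained. *)
Definition lambda_min A : R := inf [set a | eigenvalue A a].

Definition grad phi x : 'rV[R]_n := \row_(i < n) 'D_(delta_mx 0 i) phi x.

Definition hess phi x : 'M[R]_n := 'J (grad phi) x.

Definition twice_cont_diff phi : Prop :=
  [/\ forall x, differentiable phi x,
      forall x, differentiable (grad phi) x &
      continuous (hess phi)].

Definition lipschitz_hessian phi (L : R) : Prop :=
  forall x y, spec_norm (hess phi x - hess phi y) <= L * enorm (x - y).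

End Euclidean.

Section TrustRegionStep.
Context {R : realType} {n : nat}.
Implicit Types (g s x : 'rV[R]_n) (H : 'M[R]_n) (phi : 'rV[R]_n -> R).

(* The value m_k(x + s); m_k(x) is the value at s = 0. *)
Definition model phi x g H s : R := phi x + dotv g s + 2^-1 * dotv (s *m H) s.

Definition pred_decrease phi x g H s : R := model phi x g H 0 - model phi x g H s.

(* min{|g| / |H|, delta}, the quotient being +oo if H = 0. *)
Definition cauchy_length g H (delta : R) : R :=
  if H == 0 then delta else Num.min (enorm g / spec_norm H) delta.

Definition admissible_step phi (kfod : R) x g H (delta : R) s : Prop :=
  enorm s <= delta /\
  kfod / 2 * Num.max (enorm g * cauchy_length g H delta)
                     (- lambda_min H * delta ^+ 2)
    <= pred_decrease phi x g H s.

Definition rho phi (r : R) x g H s (f fp : R) : R :=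
  (f - fp + r) / pred_decrease phi x g H s.

Definition accepted phi (eta1 r : R) x g H s (f fp : R) : bool :=
  (model phi x g H 0 != model phi x g H s) && (eta1 <= rho phi r x g H s f fp).

Definition beta_m g H : R := Num.max (enorm g) (- lambda_min H).

Definition next_point (acc : bool) x s := if acc then x + s else x.

Definition next_radius (eta2 gamma : R) (acc : bool) g H (delta : R) : R :=
  if acc && (eta2 * delta <= beta_m g H) then gamma^-1 * delta else gamma * delta.

End TrustRegionStep.

Section ConditionalProbability.
Context {d : measure_display} {T : measurableType d} {R : realType}.
Variable P : probability T R.
Implicit Types (G : set (set T)) (A : set T).

Definition rv_wrt G (Y : T -> R) : Prop := preimage_set_system setT Y measurable `<=` G.

Definition mx_wrt G (m p : nat) (M : T -> 'M[R]_(m, p)) : Prop :=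
  forall i j, rv_wrt G (fun w => M w i j).

(* Y is a version of P(A | G), for a sub-sigma-algebra G. *)
Definition cond_prob_version G A (Y : T -> R) : Prop :=
  [/\ rv_wrt G Y,
      P.-integrable setT (EFin \o Y) &
      forall B, G B -> (\int[P]_(w in B) (Y w)%:E = P (A `&` B))%E].

Definition cond_prob_ge G A (p : R) : Prop :=
  exists2 Y, cond_prob_version G A Y & \forall w \ae P, p <= Y w.

Definition cond_prob_le G A (p : R) : Prop :=
  exists2 Y, cond_prob_version G A Y & \forall w \ae P, Y w <= p.

End ConditionalProbability.

(* The outputs of the oracles, as functions of their inputs and of the oracle
   randomness.  The first- and second-order oracles take the accuracy delta
   and the reliability p before the point. *)
Record oracles (R : realType) (n : nat) (Xi0 Xi1 Xi2 : Type) := Oracles {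
  zeroth_order : 'rV[R]_n -> Xi0 -> R;
  first_order : R -> R -> 'rV[R]_n -> Xi1 -> 'rV[R]_n;
  second_order : R -> R -> 'rV[R]_n -> Xi2 -> 'M[R]_n;
  second_sym : forall delta p x z, (second_order delta p x z)^T = second_order delta p x z
}.

(* The oracle randomness of each iteration (rand0 and rand0p are those of the
   function values at x_k and x_k + s_k), the iterates, steps and radii. *)
Record process (R : realType) (n : nat) (d d0 d1 d2 : measure_display)
    (T : measurableType d) (Xi0 : measurableType d0) (Xi1 : measurableType d1)
    (Xi2 : measurableType d2) := Process {
  rand0 : nat -> {mfun T >-> Xi0};
  rand0p : nat -> {mfun T >-> Xi0};
  rand1 : nat -> {mfun T >-> Xi1};
  rand2 : nat -> {mfun T >-> Xi2};
  iterate : nat -> T -> 'rV[R]_n;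
  trial_step : nat -> T -> 'rV[R]_n;
  radius : nat -> T -> R
}.

Section Run.
Context {R : realType} {n : nat} {d d0 d1 d2 : measure_display}.
Context {T : measurableType d} {Xi0 : measurableType d0}
        {Xi1 : measurableType d1} {Xi2 : measurableType d2}.
Variables (P : probability T R) (phi : 'rV[R]_n -> R).
Variables (orc : oracles R n Xi0 Xi1 Xi2) (pr : process R n T Xi0 Xi1 Xi2).

Definition Xplus k w : 'rV[R]_n := iterate pr k w + trial_step pr k w.
Definition Gk (p1 : R) k w := first_order orc (radius pr k w ^+ 2) p1 (iterate pr k w) (rand1 pr k w).
Definition Hk (p2 : R) k w := second_order orc (radius pr k w) p2 (iterate pr k w) (rand2 pr k w).
Definition Fk k w := zeroth_order orc (iterate pr k w) (rand0 pr k w).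
Definition Fplus k w := zeroth_order orc (Xplus k w) (rand0p pr k w).
Definition err k w : R := `|Fk k w - phi (iterate pr k w)|.
Definition errplus k w : R := `|Fplus k w - phi (Xplus k w)|.

Definition generated {e : measure_display} {U : measurableType e} (f : T -> U) :
  set (set T) := preimage_set_system setT f measurable.

(* past k is generated by the oracle randomness of the iterations before k
   (usually written F_{k-1}); past' k also includes the gradient and Hessian
   randomness of iteration k (F'_{k-1}). *)
Definition past k : set (set T) :=
  <<s \bigcup_(j in [set j | (j < k)%N])
        (generated (rand0 pr j) `|` generated (rand0p pr j) `|`
         generated (rand1 pr j) `|` generated (rand2 pr j)) >>.
Definition past' k : set (set T) :=
  <<s past k `|` generated (rand1 pr k) `|` generated (rand2 pr k) >>.

(* The oracle outputs of iteration k are determined measurably by the oracle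
   randomness, and s_k is computed from what is known once g_k and H_k are. *)
Definition adapted (p1 p2 : R) : Prop :=
  forall k, [/\ mx_wrt (past' k) (Gk p1 k), mx_wrt (past' k) (Hk p2 k),
                mx_wrt (past' k) (trial_step pr k),
                rv_wrt (past k.+1) (Fk k) & rv_wrt (past k.+1) (Fplus k)].

Definition runs_algorithm2 (x0 : 'rV[R]_n)
    (delta0 eta1 eta2 gamma r p1 p2 kfod : R) : Prop :=
  [/\ forall w, iterate pr 0 w = x0,
      forall w, radius pr 0 w = delta0 &
      forall k w,
        let x := iterate pr k w in let s := trial_step pr k w in let delta := radius pr k w in
        let g := Gk p1 k w in let H := Hk p2 k w in
        let acc := accepted phi eta1 r x g H s (Fk k w) (Fplus k w) in
        [/\ admissible_step phi kfod x g H delta s,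
            iterate pr k.+1 w = next_point acc x s &
            radius pr k.+1 w = next_radius eta2 gamma acc g H delta]].

Definition zeroth_guarantee (epsf a : R) : Prop :=
  forall k t, 0 <= t ->
    cond_prob_le P (past' k) [set w | t < err k w] (expR (a * (epsf - t))) /\
    cond_prob_le P (past' k) [set w | t < errplus k w] (expR (a * (epsf - t))).

Definition first_second_guarantee (epsg keg epsH keh p1 p2 : R) : Prop :=
  forall k, cond_prob_ge P (past k)
    [set w | spec_norm (Hk p2 k w - hess phi (iterate pr k w)) <= keh * radius pr k w + epsH /\
             enorm (Gk p1 k w - grad phi (iterate pr k w)) <= keg * radius pr k w ^+ 2 + epsg]
    (p1 * p2).

End Run.

Section Constants.
Context {R : realType}.
Variables (L2 keg keh eta1 eta2 kfod kbhm : R).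

Let D := L2 / 3 + 2 * keg + keh.
Let c := (1 - eta1) * kfod.

Definition C4 : R :=
  Num.min (1 / (kbhm + keg)) (Num.min (c / (D + 3 + c * keg)) (1 / (keg + eta2))).
Definition C5 : R :=
  Num.max (1 / (kbhm + keg)) (Num.max (c / (D + 3 + c * keg)) (1 / (keg + eta2))).
Definition C6 : R := Num.min (c / (D + 2 + c * keh)) (1 / (keh + eta2)).
Definition C7 : R := Num.max ((c + 1) / (D + 2 + c * keh)) (1 / (keh + eta2)).
Definition C8 : R := eta1 * eta2 * kfod / 2 * Num.min (eta2 / kbhm) 1.

Definition beta {n : nat} (phi : 'rV[R]_n -> R) (epsg epsH : R) (x : 'rV[R]_n) : R :=
  Num.max (C4 * enorm (grad phi x) - C5 * epsg)
          (- C6 * lambda_min (hess phi x) - C7 * epsH).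

End Constants.

Definition log_base {R : realType} (b y : R) : R := ln y / ln b.

(* Main.v *)
Require Import Defs.
From HB Require Import structures.
From mathcomp Require Import all_boot all_order all_algebra.
From mathcomp Require Import all_classical all_reals all_analysis.
From mathcomp Require Import measurable_realfun.
From mathcomp Require Import ring lra zify.
Import Order.TTheory GRing.Theory Num.Theory numFieldNormedType.Exports.

(** Call an iteration true when its gradient and Hessian estimates are accurate
   and its two function errors sum to at most [r - epsg^(3/2)].  At a true
   iteration where the optimality measure exceeds [eps'] and the radius does
   not, the model predicts so much decrease that the step is accepted and the
   radius grows: by Taylor's formula the model error is at most
   [D/2 delta^3 + epsg delta + epsH/2 delta^2], and the constants [C4] to [C7]
   are chosen so that the share [1 - eta1] of the predicted decrease covers it,
   the term [epsg delta] being absorbed with the help of [epsg^(3/2)]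
   ([true_step_expands]).  Conversely, an expanding step with
   [gamma eps' <= delta] decreases the function by [C8 (gamma eps')^3], up to
   the relaxation [r] and the noise ([expanding_step_decrease]).

   On the logarithmic scale the radius performs a walk with steps 1 and -1.
   Expanding steps below [gamma eps'] and contracting steps above [eps'] move
   towards the window between these two values, and each must be paid for by a
   step in the other direction, except for those that cover the initial
   distance; so they make up at most half of the iterations
   ([walk_count]).  All other true iterations are expanding with
   [gamma eps' <= delta].  If the optimality measure stayed above [eps'], this
   would bound from below the total decrease of the function, against the
   lower bound [phihat] ([trajectory_bound]).

   It remains to see that true iterations are frequent and the accumulated noise
   is small, with high probability.  The conditional hypotheses give
   inequalities [P (A & B) <= q P B] for all events [B] of the past; these extend
   to [E (Z 1_A) <= q E Z] for nonnegative [Z] measurable with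
   respect to the past ([restricted_integral_le]), so that the expectations of
   products of exponentials over the iterations are bounded by powers
   ([expectation_prod_le]).  Applied to [exp (theta (1 - 1_A / p))], whose
   exponent is at most [theta] in absolute value because [1/2 <= p], this gives
   the two Azuma-Hoeffding terms ([count_concentration]); applied to
   [exp (a/4 (E + E'))] it gives the third one ([noise_concentration]).  For
   this the iterates have to be measurable with respect to the past; the
   smallest eigenvalue enters through its continuity on symmetric matrices, and
   the Hessian is symmetric because a second difference is ([hess_sym]). *)

Set Implicit Arguments.
Unset Strict Implicit.
Unset Printing Implicit Defensive.

Local Open Scope classical_set_scope.
Local Open Scope ring_scope.

(** * The Euclidean inner product and the spectral norm *)

Section EuclideanTheory.
Context {R : realType} {n : nat}.
Implicit Types (u v w : 'rV[R]_n) (A B : 'M[R]_n).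

Lemma dotvC u v : dotv u v = dotv v u.
Proof. by apply: eq_bigr => i _; rewrite mulrC. Qed.

Lemma dotvDl u v w : dotv (u + v) w = dotv u w + dotv v w.
Proof. by rewrite -big_split; apply: eq_bigr => i _; rewrite mxE mulrDl. Qed.

Lemma dotvDr u v w : dotv w (u + v) = dotv w u + dotv w v.
Proof. by rewrite dotvC dotvDl !(dotvC w). Qed.

Lemma dotvZl k u v : dotv (k *: u) v = k * dotv u v.
Proof. by rewrite mulr_sumr; apply: eq_bigr => i _; rewrite mxE mulrA. Qed.

Lemma dotvZr k u v : dotv u (k *: v) = k * dotv u v.
Proof. by rewrite dotvC dotvZl dotvC. Qed.

Lemma dotvNl u v : dotv (- u) v = - dotv u v.
Proof. by rewrite -scaleN1r dotvZl mulN1r. Qed.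

Lemma dotvNr u v : dotv u (- v) = - dotv u v.
Proof. by rewrite dotvC dotvNl dotvC. Qed.

Lemma dotvBl u v w : dotv (u - v) w = dotv u w - dotv v w.
Proof. by rewrite dotvDl dotvNl. Qed.

Lemma dotvBr u v w : dotv w (u - v) = dotv w u - dotv w v.
Proof. by rewrite dotvDr dotvNr. Qed.

Lemma dotv0l u : dotv 0 u = 0.
Proof. by rewrite -(scale0r u) dotvZl mul0r. Qed.

Lemma dotv0r u : dotv u 0 = 0.
Proof. by rewrite dotvC dotv0l. Qed.

Lemma dotv_ge0 u : 0 <= dotv u u.
Proof. by apply: sumr_ge0 => i _; rewrite -expr2 sqr_ge0. Qed.

Lemma dotv_eq0 u : (dotv u u == 0) = (u == 0).
Proof.
apply/eqP/eqP => [|->]; last exact: dotv0l.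
move=> /psumr_eq0P u0; apply/rowP => i; rewrite mxE.
have /eqP := u0 (fun i _ => ltac:(by rewrite -expr2 sqr_ge0)) i isT.
by rewrite mulf_eq0 orbb => /eqP.
Qed.

Lemma dotv_mulmx A u v : dotv (u *m A) v = dotv u (v *m A^T).
Proof.
rewrite /dotv; under eq_bigr do rewrite mxE mulr_suml.
rewrite exchange_big /=; apply: eq_bigr => i _; rewrite mxE mulr_sumr.
by apply: eq_bigr => j _; rewrite mxE; ring.
Qed.

Lemma enorm_ge0 u : 0 <= enorm u.
Proof. exact: sqrtr_ge0. Qed.

Lemma sqr_enorm u : enorm u ^+ 2 = dotv u u.
Proof. by rewrite sqr_sqrtr ?dotv_ge0. Qed.

Lemma enorm_eq0 u : (enorm u == 0) = (u == 0).
Proof. by rewrite -dotv_eq0 -sqr_enorm sqrf_eq0. Qed.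

Lemma enorm_gt0 u : (0 < enorm u) = (u != 0).
Proof. by rewrite lt_def enorm_ge0 andbT enorm_eq0. Qed.

Lemma enorm0 : enorm (0 : 'rV[R]_n) = 0.
Proof. by apply/eqP; rewrite enorm_eq0. Qed.

Lemma enormZ k u : enorm (k *: u) = `|k| * enorm u.
Proof.
by rewrite /enorm dotvZl dotvZr mulrA -expr2 sqrtrM ?sqr_ge0 // sqrtr_sqr.
Qed.

Lemma enormN u : enorm (- u) = enorm u.
Proof. by rewrite -scaleN1r enormZ normrN1 mul1r. Qed.

Lemma enorm_le u (c : R) : 0 <= c -> dotv u u <= c ^+ 2 -> enorm u <= c.
Proof. by move=> c0 uc; rewrite -ler_sqr ?nnegrE ?enorm_ge0// sqr_enorm. Qed.

Lemma dotv_le_enorm u v : dotv u v <= enorm u * enorm v.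
Proof.
have [->|v0] := eqVneq v 0; first by rewrite dotv0r enorm0 mulr0.
have vv : 0 < dotv v v by rewrite lt_def dotv_ge0 andbT dotv_eq0.
have := dotv_ge0 (dotv v v *: u - dotv u v *: v).
rewrite !dotvBl !dotvBr !dotvZl !dotvZr (dotvC v u) => h.
have {}h : 0 <= dotv v v * (dotv u u * dotv v v - dotv u v ^+ 2) by nra.
rewrite pmulr_rge0// subr_ge0 -!sqr_enorm -exprMn in h.
apply: le_trans (ler_norm _) _.
by rewrite -ler_sqr ?nnegrE ?mulr_ge0 ?enorm_ge0// real_normK ?num_real.
Qed.

Lemma normr_dotv_le u v : `|dotv u v| <= enorm u * enorm v.
Proof.
by rewrite ler_norml dotv_le_enorm andbT lerNl -dotvNl -(enormN u) dotv_le_enorm.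
Qed.

Lemma enormD u v : enorm (u + v) <= enorm u + enorm v.
Proof.
apply: enorm_le; first by rewrite addr_ge0 ?enorm_ge0.
rewrite dotvDl !dotvDr -!sqr_enorm (dotvC v u).
by have := dotv_le_enorm u v; nra.
Qed.

Lemma enormB_le u v : enorm u - enorm v <= enorm (u - v).
Proof. by rewrite lerBlDr -{1}(subrK v u) enormD. Qed.

Lemma coord_le_enorm u i : `|u 0 i| <= enorm u.
Proof.
rewrite -ler_sqr ?nnegrE ?enorm_ge0// real_normK ?num_real// sqr_enorm.
rewrite /dotv (bigD1 i)//= expr2 lerDl sumr_ge0// => j _.
by rewrite -expr2 sqr_ge0.
Qed.

Lemma coord_le_norm (m p : nat) (M : 'M[R]_(m, p)) i j : `|M i j| <= `|M|.
Proof.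
rewrite [leRHS]/Num.norm /= mx_normrE.
exact: (le_bigmax _ (fun ij => `|M ij.1 ij.2|) (i, j)).
Qed.

Lemma enorm_le_norm u : enorm u <= n%:R * `|u|.
Proof.
apply: enorm_le; first by rewrite mulr_ge0.
apply: le_trans (_ : \sum_(i < n) `|u| ^+ 2 <= _).
  apply: ler_sum => i _.
  by rewrite -expr2 -real_normK ?num_real// ler_sqr ?nnegrE ?coord_le_norm.
rewrite sumr_const card_ord -[leLHS]mulr_natl exprMn ler_wpM2r ?sqr_ge0//.
by rewrite -natrX ler_nat; case: (n) => // k; rewrite -mulnn leq_pmulr.
Qed.

(** A crude comparison with the maximum norm: it shows that the supremum that
   defines the spectral norm is finite, and that the spectral norm is
   continuous. *)
Lemma enorm_mulmx_le_norm A u : enorm (u *m A) <= n%:R ^+ 2 * `|A| * enorm u.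
Proof.
apply: le_trans (enorm_le_norm _) _.
rewrite expr2 -!mulrA ler_wpM2l//.
rewrite [leLHS]/Num.norm /= mx_normrE; apply: bigmax_le => [|[i j] _ /=].
  by rewrite !mulr_ge0 ?enorm_ge0.
rewrite (ord1 i) mxE; apply: le_trans (ler_norm_sum _ _ _) _.
apply: le_trans (_ : \sum_(k < n) `|A| * enorm u <= _).
  apply: ler_sum => k _; rewrite normrM mulrC.
  by apply: ler_pM; rewrite ?coord_le_norm ?coord_le_enorm.
by rewrite sumr_const card_ord mulr_natl.
Qed.

Lemma has_sup_spec_norm A : has_sup [set enorm (v *m A) | v in [set v | enorm v <= 1]].
Proof.
split; first by exists (enorm (0 *m A)); exists 0 => //=; rewrite enorm0 ler01.
exists (n%:R ^+ 2 * `|A|) => _ [v /= v1 <-].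
apply: le_trans (enorm_mulmx_le_norm _ _) _.
by rewrite ler_piMr// mulr_ge0// exprn_ge0.
Qed.

(** The supremum over the unit ball bounds all vectors, by homogeneity. *)
Lemma enorm_mulmx_le A u : enorm (u *m A) <= spec_norm A * enorm u.
Proof.
have [->|u0] := eqVneq u 0; first by rewrite mul0mx enorm0 mulr0.
rewrite -ler_pdivrMr ?enorm_gt0//.
have -> : enorm (u *m A) / enorm u = enorm (((enorm u)^-1 *: u) *m A).
  by rewrite -scalemxAl enormZ mulrC ger0_norm// invr_ge0 enorm_ge0.
apply: (sup_upper_bound (has_sup_spec_norm A)); exists ((enorm u)^-1 *: u) => //=.
by rewrite enormZ ger0_norm ?invr_ge0 ?enorm_ge0// mulVf// enorm_eq0.
Qed.

Lemma spec_norm_le A (c : R) :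
  0 <= c -> (forall u, enorm (u *m A) <= c * enorm u) -> spec_norm A <= c.
Proof.
move=> c0 Ac; apply: sup_le_ub; first by have [] := has_sup_spec_norm A.
move=> _ [v /= v1 <-]; apply: le_trans (Ac v) _; exact: ler_piMr.
Qed.

Lemma spec_norm_ge0 A : 0 <= spec_norm A.
Proof.
apply: (sup_upper_bound (has_sup_spec_norm A)).
by exists 0 => /=; rewrite ?mul0mx enorm0// ler01.
Qed.

Lemma spec_norm_le_norm A : spec_norm A <= n%:R ^+ 2 * `|A|.
Proof.
by apply: spec_norm_le => [|u]; [rewrite mulr_ge0// exprn_ge0|exact: enorm_mulmx_le_norm].
Qed.

Lemma spec_normD A B : spec_norm (A + B) <= spec_norm A + spec_norm B.
Proof.
apply: spec_norm_le => [|u]; first by rewrite addr_ge0 ?spec_norm_ge0.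
by rewrite mulmxDr mulrDl; apply: le_trans (enormD _ _) (lerD _ _);
  exact: enorm_mulmx_le.
Qed.

Lemma spec_normN A : spec_norm (- A) = spec_norm A.
Proof.
have le B : spec_norm (- B) <= spec_norm B.
  apply: spec_norm_le => [|u]; first exact: spec_norm_ge0.
  by rewrite mulmxN enormN enorm_mulmx_le.
by apply/le_anti; rewrite le -{1}(opprK A) le.
Qed.

Lemma spec_normB_le A B : spec_norm A - spec_norm B <= spec_norm (A - B).
Proof. by rewrite lerBlDr -{1}(subrK B A) spec_normD. Qed.

Lemma spec_norm_gt0 A : A != 0 -> 0 < spec_norm A.
Proof.
rewrite lt_def spec_norm_ge0 andbT; apply: contra_neq => A0.
apply/row_matrixP => i; rewrite rowE row0.
by apply/eqP; rewrite -enorm_eq0 eq_le enorm_ge0 andbT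
  (le_trans (enorm_mulmx_le _ _))// A0 mul0r.
Qed.

Lemma quad_le A u : `|dotv (u *m A) u| <= spec_norm A * enorm u ^+ 2.
Proof.
apply: le_trans (normr_dotv_le _ _) _.
by rewrite expr2 mulrA ler_wpM2r ?enorm_ge0 ?enorm_mulmx_le.
Qed.

End EuclideanTheory.

(** * The smallest eigenvalue of a symmetric matrix *)

Section Continuity.
Context {R : realType}.

Lemma lipschitz_cts (V : normedModType R) (f : V -> R) (C : R) :
  (forall x y, f x - f y <= C * `|x - y|) -> continuous f.
Proof.
move=> fC x; apply/cvgrPdist_le => e e0.
have C1 : 0 < `|C| + 1 by rewrite ltr_wpDl.
near=> y; have xy : (`|C| + 1) * `|x - y| <= e.
  rewrite mulrC -ler_pdivlMr//; near: y.
  apply: cvgr_dist_le; first exact: cvg_id.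
  exact: divr_gt0.
have le (z : R) : 0 <= z -> C * z <= (`|C| + 1) * z.
  by move=> z0; rewrite ler_wpM2r// ler_wpDr// ler_norm.
rewrite ler_norml; apply/andP; split; last first.
  exact: le_trans (fC x y) (le_trans (le _ (normr_ge0 _)) xy).
rewrite lerNl opprB; apply: le_trans (fC y x) _.
by rewrite distrC; exact: le_trans (le _ (normr_ge0 _)) xy.
Unshelve. all: by end_near. Qed.

Lemma enorm_cts n : continuous (@enorm R n).
Proof.
apply: (@lipschitz_cts _ _ n%:R) => x y.
exact: le_trans (enormB_le _ _) (enorm_le_norm _).
Qed.

Lemma spec_norm_cts n : continuous (@spec_norm R n).
Proof.
apply: (@lipschitz_cts _ _ (n%:R ^+ 2)) => x y.
exact: le_trans (spec_normB_le _ _) (spec_norm_le_norm _).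
Qed.

Lemma sum_cts (V : topologicalType) (I : Type) (r : seq I) (F : I -> V -> R) :
  (forall i, continuous (F i)) -> continuous (fun x => \sum_(i <- r) F i x).
Proof.
move=> Fc; elim: r => [|i r IH] x.
  by under eq_fun do rewrite big_nil; exact: cst_continuous.
under eq_fun do rewrite big_cons.
exact: (continuousD (Fc i x) (IH x)).
Qed.

Lemma quad_cts n (A : 'M[R]_n) : continuous (fun u : 'rV[R]_n => dotv (u *m A) u).
Proof.
have -> : (fun u : 'rV[R]_n => dotv (u *m A) u) =
    (fun u => \sum_(i < n) (\sum_(j < n) u 0 j * A j i) * u 0 i).
  by apply/funext => u; apply: eq_bigr => i _; rewrite mxE.
apply: sum_cts => i x; apply: continuousM; last exact: coord_continuous.
apply: sum_cts => j {}x.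
by apply: continuousM; [exact: coord_continuous|exact: cst_continuous].
Qed.

Lemma compact_sphere n : compact [set u : 'rV[R]_n | enorm u = 1].
Proof.
apply: bounded_closed_compact.
  exists 1; split; first exact: num_real.
  move=> M M1 u /= u1; rewrite [leLHS]/Num.norm /= mx_normrE.
  apply: bigmax_le => [|[i j] _ /=]; first by rewrite (le_trans _ (ltW M1)).
  by rewrite (ord1 i); apply: le_trans (coord_le_enorm _ _) _; rewrite u1 ltW.
have -> : [set u : 'rV[R]_n | enorm u = 1] = @enorm R n @^-1` [set 1] by [].
by apply: closed_comp => [u _|]; [exact: enorm_cts|exact: closed_eq].
Qed.

End Continuity.

Section LambdaMin.
Context {R : realType} {n : nat}.
Implicit Types (u v w : 'rV[R]_n) (A B : 'M[R]_n).

Lemma quadZ A k u : dotv ((k *: u) *m A) (k *: u) = k ^+ 2 * dotv (u *m A) u.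
Proof. by rewrite -scalemxAl dotvZl dotvZr; ring. Qed.

(** In particular the infimum of a nonempty set of eigenvalues is a lower bound. *)
Lemma eigenvalue_ge A a : eigenvalue A a -> - spec_norm A <= a.
Proof.
move=> /eigenvalueP[v vA v0]; have vp : 0 < enorm v ^+ 2 by rewrite exprn_gt0 ?enorm_gt0.
have := quad_le A v; rewrite vA dotvZl -sqr_enorm normrM (ger0_norm (ltW vp)).
by rewrite ler_pM2r// ler_norml => /andP[].
Qed.

Lemma has_lbound_eigenvalue A : has_lbound [set a | eigenvalue A a].
Proof. by exists (- spec_norm A) => a; exact: eigenvalue_ge. Qed.

(** A minimiser [v] of the Rayleigh quotient on the compact unit sphere is an
   eigenvector: with [mu] its value, [B = A - mu] is positive semidefinite and
   vanishes at [v], and moving from [v] in the direction [- v B] would make it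
   negative unless [v B = 0]. *)
Lemma rayleigh_minimizer A : (0 < n)%N -> A^T = A ->
  exists mu, eigenvalue A mu /\ forall u, mu * enorm u ^+ 2 <= dotv (u *m A) u.
Proof.
move=> n0 symA.
have [|v /set_mem /= v1 vmin] := @EVT_min_rV R n (fun u => dotv (u *m A) u) _ _ (@compact_sphere R n)
  (continuous_subspaceT (@quad_cts R n A)).
  pose i0 := Ordinal n0; exists ((enorm (delta_mx 0 i0 : 'rV[R]_n))^-1 *: delta_mx 0 i0) => /=.
  rewrite enormZ ger0_norm ?invr_ge0 ?enorm_ge0// mulVf// enorm_eq0.
  by apply/eqP => /rowP/(_ i0)/eqP; rewrite !mxE !eqxx oner_eq0.
pose mu := dotv (v *m A) v; exists mu.
have muP u : mu * enorm u ^+ 2 <= dotv (u *m A) u.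
  have [->|u0] := eqVneq u 0; first by rewrite enorm0 expr0n mulr0 mul0mx dotv0l.
  have ux : 0 < enorm u by rewrite enorm_gt0.
  have := vmin ((enorm u)^-1 *: u); rewrite quadZ -/mu.
  rewrite exprVn mulrC ler_pdivlMr ?exprn_gt0//; apply.
  by apply/mem_set; rewrite /= enormZ ger0_norm ?invr_ge0 ?enorm_ge0// mulVf// gt_eqF.
split=> //; apply/eigenvalueP; exists v; last first.
  by rewrite -enorm_gt0 v1.
pose w := v *m A - mu *: v.
apply/eqP; rewrite -subr_eq0 -/w -dotv_eq0; apply/eqP.
pose c := dotv w w; pose q := dotv (w *m A) w - mu * dotv w w.
have c0 : 0 <= c := dotv_ge0 w.
have q0 : 0 <= q by rewrite subr_ge0 -sqr_enorm muP.
have main t : 0 <= - 2 * t * c + t ^+ 2 * q.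
  have expand z : dotv ((v - t *: z) *m A) (v - t *: z) -
      mu * dotv (v - t *: z) (v - t *: z) =
      - 2 * t * dotv (v *m A - mu *: v) z + t ^+ 2 * (dotv (z *m A) z - mu * dotv z z).
    rewrite mulmxBl -scalemxAl !(dotvBl, dotvBr, dotvZl, dotvZr).
    rewrite (dotv_mulmx A z v) symA -/mu -(sqr_enorm v) v1.
    by rewrite (dotvC z v) (dotvC z (v *m A)); ring.
  by have := muP (v - t *: w); rewrite sqr_enorm -subr_ge0 expand.
(* The value at [t] is [t (t q - 2 c)], negative for small [t] unless [c = 0]. *)
have := main (c / (q + 1)) => h.
have q1 : 0 < q + 1 by lra.
have {}h : 0 <= - 2 * c ^+ 2 * (q + 1) + c ^+ 2 * q.
  have -> : - 2 * c ^+ 2 * (q + 1) + c ^+ 2 * q =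
    (- 2 * (c / (q + 1)) * c + (c / (q + 1)) ^+ 2 * q) * (q + 1) ^+ 2.
    by field; rewrite gt_eqF.
  by rewrite mulr_ge0// exprn_ge0// ltW.
suff : c ^+ 2 <= 0 by rewrite -/c; nra.
by nra.
Qed.

Lemma eigenvalue_nonempty A : (0 < n)%N -> A^T = A -> [set a | eigenvalue A a] !=set0.
Proof. by move=> n0 /(rayleigh_minimizer n0)[mu []]; exists mu. Qed.

Lemma lambda_min_le_quad A u : A^T = A ->
  lambda_min A * enorm u ^+ 2 <= dotv (u *m A) u.
Proof.
move=> symA; have [n0|n0] := posnP n.
  have -> : u = 0.
    by apply/rowP => -[i lt_in]; exfalso; move: lt_in; rewrite n0.
  by rewrite enorm0 expr0n mulr0 mul0mx dotv0l.
have [mu [Amu /(_ u)]] := rayleigh_minimizer n0 symA.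
apply: le_trans; rewrite ler_wpM2r ?sqr_ge0//.
exact: (ge_inf (has_lbound_eigenvalue A)).
Qed.

(** Weyl's inequality: an eigenvector of [B] is a test vector for the Rayleigh
   quotient of the symmetric matrix [A]. *)
Lemma lambda_min_le A B : A^T = A -> [set a | eigenvalue B a] !=set0 ->
  lambda_min A <= lambda_min B + spec_norm (A - B).
Proof.
move=> symA B0; rewrite -lerBlDr; apply: lb_le_inf => // b /eigenvalueP[v vB v0].
have vp : 0 < enorm v ^+ 2 by rewrite exprn_gt0 ?enorm_gt0.
have := lambda_min_le_quad v symA; rewrite -{2}(subrK B A) mulmxDr dotvDl vB dotvZl.
rewrite -sqr_enorm => h.
have := le_trans (ler_norm _) (quad_le (A - B) v) => h2.
by rewrite lerBlDr -(ler_pM2r vp) mulrDl; lra.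
Qed.

End LambdaMin.

(** Weyl's inequality in both directions.  Symmetrising the argument makes this
   a statement about a function on all matrices. *)
Lemma lambda_min_sym_cts (R : realType) (n : nat) : (0 < n)%N ->
  continuous (fun A : 'M[R]_n => lambda_min (2^-1 *: (A + A^T))).
Proof.
move=> n0; have sym (A : 'M[R]_n) : (2^-1 *: (A + A^T))^T = 2^-1 *: (A + A^T).
  by rewrite linearZ/= linearD/= trmxK addrC.
apply: (@lipschitz_cts _ _ _ (n%:R ^+ 2)) => A B.
rewrite lerBlDl; apply: le_trans (lambda_min_le (sym A) (eigenvalue_nonempty n0 (sym B))) _.
rewrite lerD2l; apply: le_trans (spec_norm_le_norm _) _; rewrite ler_wpM2l ?exprn_ge0//.
rewrite -scalerBr normrZ ger0_norm ?invr_ge0//.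
have -> : A + A^T - (B + B^T) = (A - B) + (A - B)^T.
  by rewrite linearB/= opprD addrACA.
have tr (M : 'M[R]_n) : `|M^T| <= `|M|.
  rewrite [leLHS]/Num.norm /= mx_normrE; apply: bigmax_le => // -[i j] _ /=.
  by rewrite mxE coord_le_norm.
have := tr (A - B); have := ler_normD (A - B) (A - B)^T; lra.
Qed.

(** * Taylor expansion along a segment, and symmetry of the Hessian *)

Section LineDerivative.
Context {R : realType}.

Lemma is_derive_line (V W : normedModType R) (f : V -> W) (x s : V) (t : R) :
  derivable f (x + t *: s) s ->
  is_derive t (1 : R) (fun t => f (x + t *: s)) ('D_s f (x + t *: s)).
Proof.
have E : (fun h : R => h^-1 *: (((fun t => f (x + t *: s)) \o shift t) (h *: (1 : R)) -
    f (x + t *: s))) =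
    (fun h => h^-1 *: ((f \o shift (x + t *: s)) (h *: s) - f (x + t *: s))).
  apply/funext => h /=; congr (_ *: (f _ - _)).
  by rewrite [_ *: 1]mulr1 scalerDl addrCA.
by move=> df; apply: DeriveDef; [rewrite /derivable E|rewrite /derive E].
Qed.

(** The mean value theorem on [[0, t]], with the endpoints allowed for the
   intermediate point. *)
Lemma mean_value (f df : R -> R) (t : R) : 0 < t ->
  (forall x, is_derive x (1 : R) f (df x)) ->
  exists2 c, 0 <= c <= t & f t - f 0 = df c * t.
Proof.
move=> t0 fdf; have cf : {within `[0, t], continuous f}.
  apply: derivable_within_continuous => x _; exact: ex_derive.
have [c c0t E] := MVT t0 (fun x _ => fdf x) cf.
exists c; last by rewrite E subr0.
by move: c0t; rewrite in_itv /= => /andP[/ltW -> /ltW ->].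
Qed.

(** If the second derivative grows at most linearly, the second order Taylor
   remainder is at most cubic: integrate the bound twice. *)
Lemma taylor2_le (f f1 f2 : R -> R) (K : R) :
  (forall t, is_derive t (1 : R) f (f1 t)) ->
  (forall t, is_derive t (1 : R) f1 (f2 t)) ->
  (forall t, 0 <= t <= 1 -> f2 t <= f2 0 + K * t) ->
  f 1 <= f 0 + f1 0 + 2^-1 * f2 0 + K / 6.
Proof.
move=> df df1 f2le.
have f1le t : 0 <= t <= 1 -> f1 t <= f1 0 + f2 0 * t + K / 2 * t ^+ 2.
  move=> /andP[]; rewrite le_eqVlt => /predU1P[<- _|t0 t1].
    by rewrite expr0n !mulr0 !addr0.
  pose g t := f1 t - f2 0 * t - K / 2 * t ^+ 2.
  have dg x : is_derive x (1 : R) g (f2 x - f2 0 - K * x).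
    apply: is_derive_eq; by rewrite /GRing.scale /=; field.
  have [c /andP[c0 ct] E] := mean_value t0 dg.
  have := f2le c; rewrite c0 (le_trans ct t1) => /(_ isT) fc.
  have : g t <= g 0 by rewrite -subr_le0 E pmulr_lle0//; lra.
  by rewrite /g expr0n /=; lra.
pose g t := f t - f1 0 * t - 2^-1 * f2 0 * t ^+ 2 - K / 6 * t ^+ 3.
have dg x : is_derive x (1 : R) g (f1 x - f1 0 - f2 0 * x - K / 2 * x ^+ 2).
  by apply: is_derive_eq; rewrite /GRing.scale /=; field.
have [c c01 E] := mean_value ltr01 dg.
have : g 1 <= g 0 by rewrite -subr_le0 E; rewrite mulr1; have := f1le c c01; lra.
by rewrite /g !expr0n !expr1n /=; lra.
Qed.

End LineDerivative.

Section Hessian.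
Context {R : realType} {n : nat}.
Variables (phi : 'rV[R]_n -> R) (L2 : R).
Hypotheses (n_gt0 : (0 < n)%N) (phi2 : twice_cont_diff phi) (lipH : lipschitz_hessian phi L2).

(** Compare the Hessian at two distinct points, which exist as [0 < n]. *)
Lemma L2_ge0 : 0 <= L2.
Proof.
pose e : 'rV[R]_n := delta_mx 0 (Ordinal n_gt0).
have e0 : 0 < enorm e.
  rewrite enorm_gt0; apply/eqP => /rowP/(_ (Ordinal n_gt0))/eqP.
  by rewrite !mxE !eqxx oner_eq0.
by have := le_trans (spec_norm_ge0 _) (lipH e 0); rewrite subr0 pmulr_lge0.
Qed.

Lemma derive_gradE x s : 'D_s phi x = dotv (grad phi x) s.
Proof.
have [dphi _ _] := phi2; rewrite deriveE//.
rewrite [in LHS](row_sum_delta s) linear_sum; apply: eq_bigr => i _.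
by rewrite linearZ /= mxE deriveE// mulrC.
Qed.

Lemma derive_phi_line x s t :
  is_derive t (1 : R) (fun t => phi (x + t *: s)) (dotv (grad phi (x + t *: s)) s).
Proof.
have [dphi _ _] := phi2; rewrite -derive_gradE; apply: is_derive_line.
exact: diff_derivable.
Qed.

Lemma derive_grad_line x s v t :
  is_derive t (1 : R) (fun t => dotv (grad phi (x + t *: s)) v)
    (dotv (s *m hess phi (x + t *: s)) v).
Proof.
have [_ dgrad _] := phi2.
have dG := is_derive_line (diff_derivable (v := s) (dgrad (x + t *: s))).
have dGi i := (derivable_mxP _ _ _).1 (ex_derive (is_derive := dG)) 0 i.
have -> : (fun t => dotv (grad phi (x + t *: s)) v) =
    \sum_(i < n) (v 0 i \*: (fun t : R => grad phi (x + t *: s) 0 i)).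
  by apply/funext => y; rewrite fct_sumE; apply: eq_bigr => i _; rewrite /= mulrC.
have -> : dotv (s *m hess phi (x + t *: s)) v =
    \sum_(i < n) v 0 i *: 'D_1 (fun t : R => grad phi (x + t *: s) 0 i) t.
  apply: eq_bigr => i _; rewrite -deriveEjacobian// mulrC.
  have := derive_val (is_derive := dG); rewrite derive_mx; last exact: ex_derive.
  by move=> /rowP/(_ i); rewrite !mxE => ->.
by apply: is_derive_sum => i; apply: is_deriveZ; apply/derivableP.
Qed.

(** The Lipschitz condition makes the second derivative of [phi] along the
   segment from [x] to [x + s] grow at the rate [L2 |s|^3] at most. *)
Lemma taylor_hessian x s :
  phi (x + s) <= phi x + dotv (grad phi x) s + 2^-1 * dotv (s *m hess phi x) s
                 + L2 * enorm s ^+ 3 / 6.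
Proof.
have := taylor2_le (derive_phi_line x s) (derive_grad_line x s s) (K := L2 * enorm s ^+ 3).
rewrite scale1r scale0r addr0; apply => t /andP[t0 _].
rewrite -lerBlDl -dotvBl -mulmxBr; apply: le_trans (ler_norm _) _.
apply: le_trans (quad_le _ _) _; have := lipH (x + t *: s) x.
rewrite [x + _]addrC addrK enormZ ger0_norm// => h.
have := ler_wpM2r (sqr_ge0 (enorm s)) h; lra.
Qed.

(** The second difference of [phi] along [u] and [v] is symmetric in them, and
   two applications of the mean value theorem identify it with [<u H, v>] up to
   a cubic error. *)
Lemma second_difference x u v :
  `|phi (x + u + v) - phi (x + u) - phi (x + v) + phi x - dotv (u *m hess phi x) v|
    <= L2 * (enorm u + enorm v) * enorm u * enorm v.
Proof.
pose k t := phi (x + u + t *: v) - phi (x + t *: v).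
have dk t : is_derive t (1 : R) k
    (dotv (grad phi (x + u + t *: v)) v - dotv (grad phi (x + t *: v)) v).
  by apply: is_deriveB; exact: derive_phi_line.
have [c /andP[c0 c1]] := mean_value ltr01 dk.
rewrite /k !scale1r !scale0r !addr0 mulr1.
have [b /andP[b0 b1]] := mean_value ltr01 (derive_grad_line (x + c *: v) u v).
rewrite scale1r scale0r addr0 mulr1 (addrAC x) => -> E.
have -> : phi (x + u + v) - phi (x + u) - phi (x + v) + phi x =
    phi (x + u + v) - phi (x + v) - (phi (x + u) - phi x) by ring.
rewrite E -dotvBl -mulmxBr; apply: le_trans (normr_dotv_le _ _) _.
rewrite ler_wpM2r ?enorm_ge0//; apply: le_trans (enorm_mulmx_le _ _) _.
rewrite ler_wpM2r ?enorm_ge0//; apply: le_trans (lipH _ _) _.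
rewrite ler_wpM2l ?L2_ge0//.
have -> : x + c *: v + b *: u - x = b *: u + c *: v by apply/rowP => i; rewrite !mxE; ring.
apply: le_trans (enormD _ _) _; rewrite !enormZ !ger0_norm//.
by rewrite lerD// ler_piMl ?enorm_ge0.
Qed.

(** Exchanging [u] and [v] changes the second difference along [t u] and [t v]
   by nothing and its quadratic part by [t^2 (<u H, v> - <v H, u>)], whereas the
   error is of order [t^3]. *)
Lemma hess_sym x : (hess phi x)^T = hess phi x.
Proof.
have key u v : dotv (u *m hess phi x) v = dotv (v *m hess phi x) u.
  pose C := 2 * (L2 * (enorm u + enorm v) * enorm u * enorm v).
  have C0 : 0 <= C by rewrite !mulr_ge0 ?addr_ge0 ?enorm_ge0 ?L2_ge0.
  have small t : 0 < t -> `|dotv (u *m hess phi x) v - dotv (v *m hess phi x) u| <= t * C.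
    move=> t0; have t3 : 0 < t ^+ 2 by rewrite exprn_gt0.
    have main w z : phi (x + t *: w) + phi (x + t *: z) = phi (x + t *: u) + phi (x + t *: v) ->
      enorm w + enorm z = enorm u + enorm v -> enorm w * enorm z = enorm u * enorm v ->
      `|(phi (x + t *: w + t *: z) - (phi (x + t *: u) + phi (x + t *: v)) + phi x)
        - t ^+ 2 * dotv (w *m hess phi x) z| <= t ^+ 2 * (t * (C / 2)).
      move=> <- E1 E2; have := second_difference x (t *: w) (t *: z).
      rewrite -scalemxAl dotvZl dotvZr !enormZ (gtr0_norm t0) mulrA -expr2 opprD addrA.
      move=> /le_trans; apply; rewrite le_eqVlt; apply/orP; left; apply/eqP.
      have -> : L2 * (t * enorm w + t * enorm z) * (t * enorm w) * (t * enorm z) =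
        t ^+ 3 * L2 * (enorm w + enorm z) * (enorm w * enorm z) by ring.
      by rewrite E1 E2 /C; field.
    have Huv := main u v erefl erefl erefl.
    have Hvu := main v u (addrC _ _) (addrC _ _) (mulrC _ _).
    rewrite (addrAC x) in Hvu; rewrite -(ler_pM2l t3) -{1}(gtr0_norm t3) -normrM.
    have -> : t ^+ 2 * (t * C) = t ^+ 2 * (t * (C / 2)) + t ^+ 2 * (t * (C / 2)) by field.
    rewrite mulrBr; apply: le_trans (lerD Huv Hvu).
    by rewrite [X in _ <= X + _]distrC; exact: ler_distD.
  apply/eqP; rewrite -subr_eq0 -normr_le0; apply/ler_addgt0Pl => e e0.
  have C1 : 0 < C + 1 by lra.
  apply: le_trans (small (e / (C + 1)) _) _; first exact: divr_gt0.
  rewrite addr0 mulrAC ler_pdivrMr// ler_wpM2l ?ltW//; lra.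
apply/matrixP => i j; rewrite mxE.
have E k l : hess phi x k l = dotv (delta_mx 0 k *m hess phi x) (delta_mx 0 l).
  rewrite -rowE /dotv (bigD1 l)//= !mxE !eqxx mulr1 big1 ?addr0// => m ml.
  by rewrite !mxE (negbTE ml) andbF mulr0.
by rewrite !E key.
Qed.

End Hessian.

(** * One trust-region step *)

(** Compare [x] with the square root of [e]: either [e x <= x^3], or
   [e x <= e^(3/2)]. *)
Lemma mul_le_powR_cube (R : realType) (e x : R) : 0 <= e -> 0 <= x ->
  e * x <= e `^ (3 / 2) + x ^+ 3.
Proof.
move=> e0 x0; have [ex|xe] := leP e (x ^+ 2).
  by rewrite exprSr -[leLHS]add0r lerD ?powR_ge0 ?ler_wpM2r.
have ep : 0 < e by rewrite (le_lt_trans _ xe)// sqr_ge0.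
have -> : 3 / 2 = 1 + 2^-1 :> R by field.
rewrite powRD ?(gt_eqF ep) ?implybT// powRr1// powR12_sqrt//.
rewrite -[leLHS]addr0 lerD ?exprn_ge0// ler_wpM2l// ltW//.
by rewrite -(ger0_norm x0) -sqrtr_sqr ltr_sqrt.
Qed.

Section Step.
Context {R : realType} {n : nat}.
Variables (phi : 'rV[R]_n -> R) (L2 epsg keg epsH keh eta1 eta2 kfod kbhm r : R).
Hypotheses (n_gt0 : (0 < n)%N) (phi2 : twice_cont_diff phi)
  (lipH : lipschitz_hessian phi L2).
Hypotheses (epsg_ge0 : 0 <= epsg) (keg_ge0 : 0 <= keg) (epsH_ge0 : 0 <= epsH)
  (keh_ge0 : 0 <= keh) (epsH_le1 : epsH <= 1).
Hypotheses (eta1_gt0 : 0 < eta1) (eta1_lt1 : eta1 < 1) (eta2_gt0 : 0 < eta2)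
  (kfod_gt0 : 0 < kfod) (kbhm_gt0 : 0 < kbhm).
Variables (x g s : 'rV[R]_n) (H : 'M[R]_n) (delta f fp : R).
Hypotheses (H_le : spec_norm H <= kbhm) (delta_gt0 : 0 < delta).
Hypothesis step : admissible_step phi kfod x g H delta s.

Lemma pred_decreaseE :
  pred_decrease phi x g H s = - (dotv g s + 2^-1 * dotv (s *m H) s).
Proof. by rewrite /pred_decrease /model mul0mx !dotv0r; ring. Qed.

Lemma cauchy_length_ge0 : 0 <= cauchy_length g H delta.
Proof.
rewrite /cauchy_length; case: ifP => _; first exact: ltW.
by rewrite le_min (ltW delta_gt0) andbT divr_ge0 ?enorm_ge0 ?spec_norm_ge0.
Qed.

Lemma pred_decrease_ge_grad :
  kfod / 2 * (enorm g * cauchy_length g H delta) <= pred_decrease phi x g H s.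
Proof.
have [_] := step; apply: le_trans.
by rewrite ler_wpM2l ?divr_ge0 ?(ltW kfod_gt0)// le_max lexx.
Qed.

Lemma pred_decrease_ge_curv :
  kfod / 2 * (- lambda_min H * delta ^+ 2) <= pred_decrease phi x g H s.
Proof.
have [_] := step; apply: le_trans.
by rewrite ler_wpM2l ?divr_ge0 ?(ltW kfod_gt0)// le_max lexx orbT.
Qed.

Lemma pred_decrease_ge0 : 0 <= pred_decrease phi x g H s.
Proof.
apply: le_trans pred_decrease_ge_grad.
by rewrite !mulr_ge0 ?invr_ge0 ?enorm_ge0 ?cauchy_length_ge0 ?ltW.
Qed.

(** Taylor's formula, with the derivatives of [phi] replaced by their estimates
   and [|s| <= delta]. *)
Lemma model_error :
  spec_norm (H - hess phi x) <= keh * delta + epsH ->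
  enorm (g - grad phi x) <= keg * delta ^+ 2 + epsg ->
  phi (x + s) <= phi x - pred_decrease phi x g H s
    + 2^-1 * (L2 / 3 + 2 * keg + keh) * delta ^+ 3 + epsg * delta
    + 2^-1 * epsH * delta ^+ 2.
Proof.
move=> accH accg; have [s_le _] := step; have sp := enorm_ge0 s.
apply: le_trans (taylor_hessian phi2 lipH x s) _; rewrite pred_decreaseE.
have e1 : dotv (grad phi x) s - dotv g s <= (keg * delta ^+ 2 + epsg) * delta.
  have := dotv_le_enorm (g - grad phi x) (- s); rewrite dotvNr dotvBl opprB enormN.
  move=> /le_trans; apply; apply: ler_pM => //; exact: enorm_ge0.
have e2 : dotv (s *m hess phi x) s - dotv (s *m H) s <= (keh * delta + epsH) * delta ^+ 2.
  have := le_trans (ler_norm _) (quad_le (hess phi x - H) s).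
  rewrite mulmxBr dotvBl -(spec_normN (_ - H)) opprB => /le_trans; apply.
  by apply: ler_pM; rewrite ?spec_norm_ge0 ?sqr_ge0// ler_sqr ?nnegrE ?(ltW delta_gt0).
have e3 : L2 * enorm s ^+ 3 <= L2 * delta ^+ 3.
  by rewrite ler_wpM2l ?(L2_ge0 n_gt0 lipH)// lerXn2r ?nnegrE ?(ltW delta_gt0).
by rewrite -subr_ge0; lra.
Qed.

(** The relaxation [r] makes up for the function noise and for the term
   [epsg^(3/2)] that the decrease of [phi] may lack. *)
Lemma acceptedP : 0 < pred_decrease phi x g H s ->
  `|f - phi x| + `|fp - phi (x + s)| <= r - epsg `^ (3 / 2) ->
  phi (x + s) <= phi x - eta1 * pred_decrease phi x g H s + epsg `^ (3 / 2) ->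
  accepted phi eta1 r x g H s f fp.
Proof.
move=> P0 noise dec; apply/andP; split.
  by apply/eqP => E; move: P0; rewrite /pred_decrease E subrr ltxx.
rewrite /rho ler_pdivlMr//.
have := ler_norm (- (f - phi x)); have := ler_norm (fp - phi (x + s)).
by rewrite normrN; lra.
Qed.

Local Notation D := (L2 / 3 + 2 * keg + keh).
Local Notation c := ((1 - eta1) * kfod).

Let D_ge0 : 0 <= D.
Proof. by have := L2_ge0 n_gt0 lipH; move: keg_ge0 keh_ge0; lra. Qed.

Let c_gt0 : 0 < c.
Proof. by rewrite mulr_gt0// subr_gt0. Qed.

(** How a bound in terms of the extreme constants of the optimality measure, the
   minimum [lo] and the maximum [hi], yields one for each of the quotients. *)
Lemma constants_gap (lo hi num den G e z : R) : 0 < den -> 0 <= G -> 0 <= e ->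
  lo <= num / den -> num / den <= hi -> z < lo * G - hi * e ->
  z * den < num * (G - e).
Proof.
move=> d0 G0 e0 lo_le hi_ge zlt; rewrite -ltr_pdivlMr// mulrAC.
apply: lt_le_trans zlt _; rewrite mulrBr.
by rewrite lerB// ler_wpM2r.
Qed.

(** The three quotients in [C4] and [C5] serve three purposes: the first makes
   the Cauchy step run to the boundary of the trust region, the second makes its
   decrease dominate the model error, the third makes the radius grow.  Since
   [delta <= 1], the cubic part of the model error is at most quadratic. *)
Lemma accepted_of_grad :
  delta <= 1 ->
  spec_norm (H - hess phi x) <= keh * delta + epsH ->
  enorm (g - grad phi x) <= keg * delta ^+ 2 + epsg ->
  `|f - phi x| + `|fp - phi (x + s)| <= r - epsg `^ (3 / 2) ->
  delta < C4 L2 keg keh eta1 eta2 kfod kbhm * enorm (grad phi x)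
          - C5 L2 keg keh eta1 eta2 kfod kbhm * epsg ->
  accepted phi eta1 r x g H s f fp /\ eta2 * delta <= beta_m g H.
Proof.
move=> d1 accH accg noise big; have G0 := enorm_ge0 (grad phi x).
move: (D_ge0) (c_gt0) (keg_ge0) (eta2_gt0) (kbhm_gt0) (delta_gt0) => D0 c0 keg0 eta20 kbhm0 delta0.
have ckeg : 0 <= c * keg by rewrite mulr_ge0// ltW.
have g1 : delta * (kbhm + keg) < 1 * (enorm (grad phi x) - epsg).
  apply: constants_gap big => //; [lra|by rewrite ge_min lexx|by rewrite le_max lexx].
have g2 : delta * (D + 3 + c * keg) < c * (enorm (grad phi x) - epsg).
  apply: constants_gap big => //; first lra.
    by rewrite /C4 /= !ge_min lexx orbT.
  by rewrite /C5 /= !le_max lexx orbT.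
have g3 : delta * (keg + eta2) < 1 * (enorm (grad phi x) - epsg).
  apply: constants_gap big => //; first lra.
    by rewrite /C4 /= !ge_min lexx !orbT.
  by rewrite /C5 /= !le_max lexx !orbT.
have g_ge : enorm (grad phi x) - epsg - keg * delta <= enorm g.
  have := enormB_le (grad phi x) g; rewrite -(enormN (_ - g)) opprB.
  have : keg * delta ^+ 2 <= keg * delta.
    by rewrite ler_wpM2l// expr2 ler_piMr// ltW.
  lra.
have length : cauchy_length g H delta = delta.
  rewrite /cauchy_length; case: ifPn => // H0; apply/min_idPr.
  rewrite ler_pdivlMr ?spec_norm_gt0//.
  have := ler_wpM2l (ltW delta_gt0) H_le; lra.
have P_ge := pred_decrease_ge_grad; rewrite length in P_ge.
split; last by rewrite /beta_m le_max; apply/orP; left; lra.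
have cg : (D + 3) * delta <= c * enorm g.
  by have := ler_wpM2l (ltW c_gt0) g_ge; lra.
have d2 : delta ^+ 3 <= delta ^+ 2 by rewrite exprS ler_piMl// sqr_ge0.
have eH2 : epsH * delta ^+ 2 <= delta ^+ 2 by rewrite ler_piMl// sqr_ge0.
have D3 : D * delta ^+ 3 <= D * delta ^+ 2 by rewrite ler_wpM2l.
have gp : 0 < enorm g by have := mulr_gt0 eta2_gt0 delta_gt0; lra.
apply: acceptedP => //.
  by apply: lt_le_trans P_ge; rewrite !mulr_gt0// invr_gt0.
apply: le_trans (model_error accH accg) _.
have := mul_le_powR_cube epsg_ge0 (ltW delta_gt0).
have : 0 <= 1 - eta1 by rewrite subr_ge0 ltW.
move=> /ler_wpM2l/(_ _ _ P_ge); rewrite mulrA (mulrA (1 - eta1)).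
have := ler_wpM2r (ltW delta_gt0) cg; rewrite expr2 in d2 eH2 D3 *.
lra.
Qed.

(** Weyl's inequality carries the negative curvature of [phi] over to the model;
   the decrease is then cubic in the radius, as the model error is. *)
Lemma accepted_of_curv :
  H^T = H ->
  spec_norm (H - hess phi x) <= keh * delta + epsH ->
  enorm (g - grad phi x) <= keg * delta ^+ 2 + epsg ->
  `|f - phi x| + `|fp - phi (x + s)| <= r - epsg `^ (3 / 2) ->
  delta < - C6 L2 keg keh eta1 eta2 kfod * lambda_min (hess phi x)
          - C7 L2 keg keh eta1 eta2 kfod * epsH ->
  accepted phi eta1 r x g H s f fp /\ eta2 * delta <= beta_m g H.
Proof.
move=> symH accH accg noise big.
move: (D_ge0) (c_gt0) (keh_ge0) (epsH_ge0) (eta2_gt0) (delta_gt0) => D0 c0 keh0 epsH0 eta20 delta0.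
have ckeh : 0 <= c * keh by rewrite mulr_ge0// ltW.
have C6_gt0 : 0 < C6 L2 keg keh eta1 eta2 kfod.
  by rewrite lt_min !divr_gt0//; lra.
have C7_gt0 : 0 < C7 L2 keg keh eta1 eta2 kfod.
  by rewrite lt_max [X in _ || X]divr_gt0 ?orbT//; lra.
have lam_lt0 : 0 < - lambda_min (hess phi x).
  rewrite -(pmulr_rgt0 _ C6_gt0) mulrN -mulNr.
  by have := mulr_ge0 (ltW C7_gt0) epsH0; clear ckeh D0 c0 keh0 C6_gt0; lra.
rewrite mulNr -mulrN in big.
have l1 : delta * (D + 2 + c * keh) < c * (- lambda_min (hess phi x)) - (c + 1) * epsH.
  rewrite -ltr_pdivlMr; last lra.
  apply: lt_le_trans big _; rewrite mulrBl (mulrAC c) (mulrAC (c + 1)) lerB//.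
    by rewrite ler_wpM2r ?(ltW lam_lt0)// /C6 /= ge_min lexx.
  by rewrite ler_wpM2r// /C7 /= le_max lexx.
have l2 : delta * (keh + eta2) < 1 * (- lambda_min (hess phi x) - epsH).
  apply: constants_gap big => //; [lra|exact: ltW| |].
    by rewrite /C6 /= ge_min lexx orbT.
  by rewrite /C7 /= le_max lexx orbT.
have weyl : - lambda_min (hess phi x) - keh * delta - epsH <= - lambda_min H.
  (* Without eigenvalues [lambda_min] would be the default value 0. *)
  have [E0|/set0P E0] := eqVneq [set a | eigenvalue (hess phi x) a] set0.
    by move: lam_lt0; rewrite /lambda_min E0 inf0 oppr0 ltxx.
  rewrite -addrA -opprD -opprD lerN2.
  by apply: le_trans (lambda_min_le symH E0) _; rewrite lerD2l.
have {symH} P_ge := pred_decrease_ge_curv.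
move: l1 l2 weyl P_ge {big lam_lt0}; rewrite /beta_m.
move: (lambda_min (hess phi x)) (lambda_min H) => lx lH l1 l2 weyl P_ge.
have cl : (D + 2) * delta + epsH <= c * - lH.
  by have := ler_wpM2l (ltW c0) weyl; lra.
split.
  have lp : 0 < - lH.
    by rewrite -(pmulr_rgt0 _ c0); have := mulr_ge0 D0 (ltW delta0); lra.
  apply: acceptedP => //.
    by apply: lt_le_trans P_ge; rewrite !mulr_gt0 ?exprn_gt0// invr_gt0.
  apply: le_trans (model_error accH accg) _.
  have := mul_le_powR_cube epsg_ge0 (ltW delta_gt0).
  have : 0 <= 1 - eta1 by rewrite subr_ge0 ltW.
  move=> /ler_wpM2l/(_ _ _ P_ge); rewrite mulrA (mulrA (1 - eta1)).
  have := ler_wpM2r (sqr_ge0 delta) cl; rewrite [delta ^+ 3]exprS.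
  by lra.
by rewrite le_max; apply/orP; right; lra.
Qed.

(** The maximum in the optimality measure is attained by the gradient or by the
   curvature term. *)
Lemma true_step_expands :
  H^T = H ->
  delta <= 1 ->
  spec_norm (H - hess phi x) <= keh * delta + epsH ->
  enorm (g - grad phi x) <= keg * delta ^+ 2 + epsg ->
  `|f - phi x| + `|fp - phi (x + s)| <= r - epsg `^ (3 / 2) ->
  delta < beta L2 keg keh eta1 eta2 kfod kbhm phi epsg epsH x ->
  accepted phi eta1 r x g H s f fp && (eta2 * delta <= beta_m g H).
Proof.
move=> symH d1 accH accg noise; rewrite /beta lt_max => /orP[] big; apply/andP.
  exact: accepted_of_grad big.
exact: accepted_of_curv big.
Qed.

Lemma accepted_decrease : accepted phi eta1 r x g H s f fp ->
  phi (x + s) <= phi x - eta1 * pred_decrease phi x g H s + r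
    + (`|f - phi x| + `|fp - phi (x + s)|).
Proof.
move=> /andP[P_neq]; have P0 : 0 < pred_decrease phi x g H s.
  by rewrite lt_def pred_decrease_ge0 andbT subr_eq0.
rewrite /rho ler_pdivlMr//.
have := ler_norm (f - phi x); have := ler_norm (- (fp - phi (x + s))).
by rewrite normrN; lra.
Qed.

(** The criticality measure of the model is attained by the gradient, and then
   the predicted decrease is of order [delta^2], or by the curvature, and then it
   is of order [delta^3]; both are at least [e^3] since [e <= 1] and
   [e <= delta]. *)
Lemma expanding_step_decrease (e : R) : 0 < e -> e <= 1 -> e <= delta ->
  accepted phi eta1 r x g H s f fp -> eta2 * delta <= beta_m g H ->
  phi (x + s) <= phi x - C8 eta1 eta2 kfod kbhm * e ^+ 3
    + r + (`|f - phi x| + `|fp - phi (x + s)|).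
Proof.
move=> e0 e1 ed acc bm; have [e_ge0 eta2_ge0] := (ltW e0, ltW eta2_gt0).
have d_ge0 := ltW delta_gt0.
have e2d : e ^+ 3 <= delta ^+ 2.
  apply: (@le_trans _ _ (e ^+ 2)); last by rewrite lerXn2r.
  by rewrite exprS ler_piMl ?sqr_ge0.
have e3d : e ^+ 3 <= delta ^+ 3 by rewrite lerXn2r.
pose m := Num.min (eta2 / kbhm) 1.
have m_ge0 : 0 <= m by rewrite le_min ler01 andbT divr_ge0// ltW.
have pf : 0 <= kfod / 2 by rewrite divr_ge0// ltW.
have P_ge : kfod / 2 * (eta2 * e ^+ 3 * m) <= pred_decrease phi x g H s.
  have [bg|bl] := leP (eta2 * delta) (enorm g).
    apply: le_trans pred_decrease_ge_grad; rewrite ler_wpM2l//.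
    apply: (@le_trans _ _ ((eta2 * delta) * (m * delta))).
      have -> : eta2 * delta * (m * delta) = eta2 * delta ^+ 2 * m by ring.
      by rewrite ler_wpM2r// ler_wpM2l.
    apply: ler_pM => //; [exact: mulr_ge0|exact: mulr_ge0|].
    rewrite /cauchy_length; case: ifPn => [_|H0].
      by rewrite ler_piMl// ge_min lexx orbT.
    rewrite le_min; apply/andP; split; last by rewrite ler_piMl// ge_min lexx orbT.
    have H_gt0 := spec_norm_gt0 H0.
    apply: (@le_trans _ _ (eta2 * delta / kbhm)).
      by rewrite mulrAC ler_wpM2r// ge_min lexx.
    by apply: ler_pM; rewrite ?invr_ge0 ?mulr_ge0 ?(ltW kbhm_gt0)// lef_pV2.
  have {}bl : eta2 * delta <= - lambda_min H.
    by move: bm; rewrite /beta_m le_max leNgt bl.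
  apply: le_trans pred_decrease_ge_curv; rewrite ler_wpM2l//.
  apply: (@le_trans _ _ (eta2 * e ^+ 3)).
    by rewrite ler_piMr ?mulr_ge0 ?exprn_ge0// ge_min lexx orbT.
  apply: (@le_trans _ _ (eta2 * delta * delta ^+ 2)).
    by rewrite -mulrA -exprS ler_wpM2l.
  by rewrite ler_wpM2r ?exprn_ge0.
have := accepted_decrease acc; have := ler_wpM2l (ltW eta1_gt0) P_ge.
rewrite /C8 -/m; lra.
Qed.

Lemma accepted_step_increase :
  accepted phi eta1 r x g H s f fp ->
  phi (x + s) <= phi x + r + (`|f - phi x| + `|fp - phi (x + s)|).
Proof.
move=> acc; have := accepted_decrease acc.
by have := mulr_ge0 (ltW eta1_gt0) pred_decrease_ge0; lra.
Qed.

End Step.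

(** * Counting the expanding iterations with a large radius *)

Section Walk.
Context {R : realType}.

(** A potential for a walk with unit steps: it vanishes on [[-1, 0]], and rounding
   up makes it change by exactly one along every step that starts outside this
   window and goes towards it, even if that step ends inside. *)
Definition excess (a : R) : int :=
  Num.max (Num.ceil a) (Num.max (Num.ceil (- 1 - a)) 0).

(** Inward steps lower the potential by one, all others raise it by at most
   one. *)
Lemma excess_step (a : R) (up : bool) :
  2 * ((up && (a < - 1)) || (~~ up && (0 < a)))%:Z +
    excess (if up then a + 1 else a - 1) <= 1 + excess a.
Proof.
have int1 : (1 : R) \is a Num.int by exact: rpred1.
have cD b : Num.ceil (b + 1 : R) = Num.ceil b + 1 by rewrite ceilDrz// ceil1.
have cB b : Num.ceil (b - 1 : R) = Num.ceil b - 1.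
  by apply: (addIr 1); rewrite -cD !subrK.
rewrite /excess; case: up => /=.
  have -> : - 1 - (a + 1) = - 1 - a - 1 by ring.
  rewrite cD cB orbF; case: ltP => ha.
    have h1 : 0 < Num.ceil (- 1 - a) by rewrite ceil_gt0; lra.
    have h2 : Num.ceil a <= - 1 by rewrite ceil_le_int; lra.
    lia.
  have h1 : Num.ceil (- 1 - a) <= 0 by rewrite ceil_le0; lra.
  lia.
have -> : - 1 - (a - 1) = - 1 - a + 1 by ring.
rewrite cD cB; case: ltP => ha /=.
  have h1 : 0 < Num.ceil a by rewrite ceil_gt0.
  have h2 : Num.ceil (- 1 - a) <= - 1 by rewrite ceil_le_int; lra.
  lia.
have h1 : Num.ceil a <= 0 by rewrite ceil_le0.
lia.
Qed.

Lemma excess_ge0 (a : R) : 0 <= excess a.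
Proof. by rewrite !le_max lexx !orbT. Qed.

Lemma excess_le (a : R) : (excess a)%:~R <= `|a| + 1.
Proof.
have h (b : R) : b <= `|a| -> (Num.ceil b)%:~R <= `|a| + 1.
  by move=> ba; have := ceilB1_lt b; rewrite intrD; lra.
have a0 := normr_ge0 a.
rewrite /excess /Num.max /Order.max; case: ifP => _; last by apply: h; exact: ler_norm.
case: ifP => _; first by rewrite addr_ge0.
by apply: h; have := ler_norm (- a); rewrite normrN; lra.
Qed.

(** Inward steps are paid for by the steps that raise the potential, except for
   those that use up its initial value. *)
Lemma walk_count (a : nat -> R) (up : nat -> bool) :
  (forall k, a k.+1 = if up k then a k + 1 else a k - 1) ->
  forall N, 2 * (\sum_(k < N) ((up k && (a k < - 1)%R) || (~~ up k && (0 < a k)%R)))%N%:R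
    <= N%:R + `|a 0%N| + 1.
Proof.
move=> aS N; set b := fun k : nat => (up k && (a k < - 1)) || (~~ up k && (0 < a k)).
have main : 2 * (\sum_(k < N) b k)%N%:Z + excess (a N) <= N%:Z + excess (a 0%N).
  elim: N => [|N IH]; first by rewrite big_ord0.
  rewrite big_ord_recr /= aS; have := excess_step (a N) (up N); rewrite -/(b N).
  move: IH; move: (excess (if _ then _ else _)) (excess (a N)) (excess (a 0%N)) => e1 e2 e3.
  move: (\sum_(k < N) b k)%N (b N) => S c; lia.
have : 2 * (\sum_(k < N) b k)%N%:Z <= N%:Z + excess (a 0%N).
  by have := excess_ge0 (a N); lia.
rewrite -(ler_int R) intrM intrD => h1.
by have := excess_le (a 0%N); lra.
Qed.

End Walk.

Section Trajectory.
Context {R : realType} {n : nat}.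
Variables (phi : 'rV[R]_n -> R) (L2 epsg keg epsH keh eta1 eta2 gamma kfod kbhm r : R).
Hypotheses (n_gt0 : (0 < n)%N) (phi2 : twice_cont_diff phi)
  (lipH : lipschitz_hessian phi L2).
Hypotheses (epsg_ge0 : 0 <= epsg) (keg_ge0 : 0 <= keg) (epsH_ge0 : 0 <= epsH)
  (keh_ge0 : 0 <= keh) (epsH_le1 : epsH <= 1).
Hypotheses (eta1_gt0 : 0 < eta1) (eta1_lt1 : eta1 < 1) (eta2_gt0 : 0 < eta2)
  (gamma_gt0 : 0 < gamma) (gamma_lt1 : gamma < 1)
  (kfod_gt0 : 0 < kfod) (kbhm_gt0 : 0 < kbhm) (r_gt0 : 0 < r).
Variables (x g s : nat -> 'rV[R]_n) (H : nat -> 'M[R]_n) (delta f fp : nat -> R).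

Local Notation acc k := (accepted phi eta1 r (x k) (g k) (H k) (s k) (f k) (fp k)).
Local Notation noise k := (`|f k - phi (x k)| + `|fp k - phi (x k + s k)|).

Definition accurate k : bool :=
  (spec_norm (H k - hess phi (x k)) <= keh * delta k + epsH) &&
  (enorm (g k - grad phi (x k)) <= keg * delta k ^+ 2 + epsg).

Definition low_noise k : bool := noise k <= r - epsg `^ (3 / 2).

Definition expanding k : bool := acc k && (eta2 * delta k <= beta_m (g k) (H k)).

Hypothesis symH : forall k, (H k)^T = H k.
Hypothesis H_le : forall k, spec_norm (H k) <= kbhm.
Hypothesis delta0_gt0 : 0 < delta 0%N.
Hypothesis step : forall k, admissible_step phi kfod (x k) (g k) (H k) (delta k) (s k).
Hypothesis xS : forall k, x k.+1 = next_point (acc k) (x k) (s k).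
Hypothesis deltaS : forall k,
  delta k.+1 = next_radius eta2 gamma (acc k) (g k) (H k) (delta k).

Lemma radius_gt0 k : 0 < delta k.
Proof.
elim: k => // k IH; rewrite deltaS /next_radius.
by case: ifP => _; rewrite mulr_gt0 ?invr_gt0.
Qed.

Variable e : R.
Hypotheses (e_gt0 : 0 < e) (e_le1 : e <= 1).

(** The radius in units of [e], on the scale on which expansion and contraction
   are unit steps. *)
Definition level k : R := ln (delta k / e) / - ln gamma.

Let lngamma : 0 < - ln gamma.
Proof. by rewrite oppr_gt0 ln_lt0// gamma_gt0. Qed.

Lemma levelS k : level k.+1 = if expanding k then level k + 1 else level k - 1.
Proof.
have g_pos : gamma \is Num.pos by rewrite posrE.
have d_pos : delta k / e \is Num.pos by rewrite posrE divr_gt0 ?radius_gt0.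
have l0 : - ln gamma != 0 by rewrite gt_eqF.
rewrite /level deltaS /next_radius /expanding; case: ifP => _; rewrite -mulrA.
  rewrite lnM ?posrE ?invr_gt0// lnV// mulrDl divff// addrC.
  by [].
have gg : ln gamma / - ln gamma = - 1 by rewrite invrN mulrN divff// -oppr_eq0.
by rewrite lnM// mulrDl gg addrC.
Qed.

Lemma level_le0 k : (level k <= 0) = (delta k <= e).
Proof.
rewrite /level ler_pdivrMr// mul0r -ln1.
by rewrite ler_ln ?posrE ?divr_gt0 ?radius_gt0// ler_pdivrMr// mul1r.
Qed.

Lemma level_geN1 k : (- 1 <= level k) = (gamma * e <= delta k).
Proof.
rewrite /level ler_pdivlMr// mulN1r opprK.
by rewrite ler_ln ?posrE ?divr_gt0 ?radius_gt0// ler_pdivlMr.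
Qed.

Variable N : nat.
Hypothesis large_beta : forall k, (k < N)%N ->
  e < beta L2 keg keh eta1 eta2 kfod kbhm phi epsg epsH (x k).

Lemma true_expanding k : (k < N)%N -> accurate k -> low_noise k -> level k <= 0 ->
  expanding k.
Proof.
move=> kN /andP[accH accg] ln; rewrite level_le0 => de.
have d1 := le_trans de e_le1.
have db := le_lt_trans de (large_beta kN).
exact: (true_step_expands n_gt0 phi2 lipH epsg_ge0 keg_ge0 epsH_ge0 keh_ge0
  epsH_le1 eta1_lt1 eta2_gt0 kfod_gt0 kbhm_gt0 (H_le k)
  (radius_gt0 k) (step k) (symH k) d1 accH accg ln db).
Qed.

Definition large_expanding k : bool := expanding k && (- 1 <= level k).

(** A true iteration is expanding unless its level is positive; those that are
   expanding below level [-1] or contracting above level [0] are inward steps. *)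
Lemma count_large_expanding :
  (\sum_(k < N) accurate k)%N%:R + (\sum_(k < N) low_noise k)%N%:R
    - (3 / 2 * N%:R + 2^-1 * `|level 0| + 2^-1)
  <= (\sum_(k < N) large_expanding k)%N%:R :> R.
Proof.
pose bad k := (expanding k && (level k < - 1)) || (~~ expanding k && (0 < level k)).
have : (\sum_(k < N) accurate k + \sum_(k < N) low_noise k <=
    N + \sum_(k < N) large_expanding k + \sum_(k < N) bad k)%N.
  rewrite -[X in (_ <= X + _ + _)%N](card_ord N) -sum1_card -!big_split /=; apply: leq_sum => k _.
  have := @true_expanding k (ltn_ord k); rewrite /large_expanding /bad.
  rewrite (ltNge 0) (ltNge _ (- 1)).
  case: (accurate k); case: (low_noise k); case: (expanding k) => //=;
    case: (- 1 <= level k) => //=; case: (level k <= 0) => //= h;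
    by have := h isT isT isT.
rewrite -(ler_nat R) !natrD; have := walk_count levelS N; rewrite -/bad => h1 h2.
by lra.
Qed.

Lemma decrease_along :
  phi (x N) <= phi (x 0%N)
    - C8 eta1 eta2 kfod kbhm * (gamma * e) ^+ 3 * (\sum_(k < N) large_expanding k)%N%:R
    + N%:R * r + \sum_(k < N) noise k.
Proof.
have ge0 : 0 < gamma * e by rewrite mulr_gt0.
have ge1 : gamma * e <= 1 by rewrite mulr_ile1// ltW.
clear large_beta; elim: N => [|m IH].
  by rewrite !big_ord0; lra.
rewrite !big_ord_recr /= natrD -[in X in X * r]addn1 natrD.
suff : phi (x m.+1) <= phi (x m)
    - C8 eta1 eta2 kfod kbhm * (gamma * e) ^+ 3 * (large_expanding m)%:R + r + noise m.
  lra.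
have n0 : 0 <= noise m by rewrite addr_ge0.
have d0 := radius_gt0 m; have r0 := r_gt0.
rewrite xS /large_expanding /expanding /next_point; case: (boolP (acc m)) => am /=; last first.
  by rewrite mulr0; lra.
case: (boolP (_ && _)) => [/andP[bm]|_]; last first.
  rewrite mulr0 subr0; exact: (accepted_step_increase eta1_gt0 kfod_gt0 d0 (step m)).
rewrite level_geN1 mulr1 => de.
exact: (expanding_step_decrease eta1_gt0 eta2_gt0 kfod_gt0 kbhm_gt0 (H_le m) d0 (step m)).
Qed.

(** Each large expanding iteration uses up a fixed part of the initial gap
   [phi (x 0) - phihat]. *)
Lemma trajectory_bound phihat : (forall y, phihat <= phi y) ->
  C8 eta1 eta2 kfod kbhm * (gamma * e) ^+ 3 *
    ((\sum_(k < N) accurate k)%N%:R + (\sum_(k < N) low_noise k)%N%:R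
      - (3 / 2 * N%:R + 2^-1 * `|level 0| + 2^-1))
  <= phi (x 0%N) - phihat + N%:R * r + \sum_(k < N) noise k.
Proof.
move=> lb; have C8_ge0 : 0 <= C8 eta1 eta2 kfod kbhm * (gamma * e) ^+ 3.
  rewrite /C8 mulr_ge0// ?exprn_ge0// ?mulr_ge0// ?(ltW gamma_gt0) ?(ltW e_gt0)//;
  by rewrite ?invr_ge0 ?ltW// lt_min ltr01 andbT divr_gt0.
have := ler_wpM2l C8_ge0 count_large_expanding.
have := decrease_along; have := lb (x N); lra.
Qed.

End Trajectory.

(** * Continuous functions of random matrices *)

Section MeasurableMatrix.
Context {d : measure_display} {S : measurableType d} {R : realType}.

(** An open set of matrices is a union of countably many boxes with rational
   centres, and the preimage of a box is a finite intersection. *)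
Lemma measurable_entrywise_open (m p : nat) (M : S -> 'M[R]_(m, p)) (O : set 'M[R]_(m, p)) :
  (forall i j, measurable_fun setT (fun w => M w i j)) -> open O ->
  measurable (M @^-1` O).
Proof.
move=> mM oO.
pose box (qk : 'M[rat]_(m, p) * nat) :=
  [set A : 'M[R]_(m, p) | forall i j, `|A i j - ratr (qk.1 i j)| < qk.2.+1%:R^-1].
have box_measurable qk : measurable (M @^-1` box qk).
  have -> : M @^-1` box qk = \bigcap_(ij in [set: 'I_m * 'I_p])
      ((fun w => `|M w ij.1 ij.2 - ratr (qk.1 ij.1 ij.2)|) @^-1` [set z | z < qk.2.+1%:R^-1]).
    apply/seteqP; split=> w /= h; first by move=> [i j] _ /=; exact: h.
    by move=> i j; exact: (h (i, j)).
  apply: fin_bigcap_measurable => // -[i j] _ /=; rewrite -[X in measurable X]setTI.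
  have mf : measurable_fun setT (fun w => `|M w i j - ratr (qk.1 i j)|).
    by apply: measurableT_comp => //; apply: measurable_funB => //; exact: measurable_cst.
  apply: mf => //; have -> : [set z : R | z < qk.2.+1%:R^-1] = `]-oo, (qk.2.+1%:R^-1)[%classic.
    by apply/seteqP; split=> z /=; rewrite in_itv.
  exact: measurable_itv.
have -> : M @^-1` O = \bigcup_(qk in [set qk | box qk `<=` O]) (M @^-1` box qk).
  apply/seteqP; split=> [w /= Ow|w [qk /= sub]]; last exact: sub.
  have [e /= e0 eO] := (nbhs_ballP _ _).1 (open_nbhs_nbhs (conj oO Ow)).
  have [k ke] : exists k, k.+1%:R^-1 < e / 2.
    have [|k] := @ltr_add_invr R 0 (e / 2); first by rewrite divr_gt0.
    by rewrite add0r; exists k.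
  have q_ex (z : R) : exists q : rat, `|z - ratr q| < k.+1%:R^-1.
    have [|q] := @rat_in_itvoo R (z - k.+1%:R^-1) (z + k.+1%:R^-1).
      by rewrite ltrBlDr -addrA ltrDl -mulr2n mulrn_wgt0// invr_gt0.
    by rewrite in_itv => /= /andP[h1 h2]; exists q; rewrite distrC ltr_distl h1.
  pose q : 'M[rat]_(m, p) := \matrix_(i, j) projT1 (cid (q_ex (M w i j))).
  have qP i j : `|M w i j - ratr (q i j)| < k.+1%:R^-1.
    by rewrite mxE; exact: projT2 (cid (q_ex _)).
  exists (q, k) => //= A boxA; apply: eO; split=> // i j.
  rewrite /ball /=; have := qP i j; have := boxA i j => /= h1 h2.
  have := ler_distD (ratr (q i j)) (M w i j) (A i j).
  rewrite (distrC (ratr _)) => /le_lt_trans; apply.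
  by apply: lt_trans (ltrD h2 h1) _; rewrite [ltRHS]splitr ltrD.
rewrite bigcup_mkcond; apply: countable_bigcupT_measurable => [|qk].
  exact: countableP.
by case: ifP.
Qed.

Lemma measurable_cts_entrywise (m p : nat) (M : S -> 'M[R]_(m, p)) (f : 'M[R]_(m, p) -> R) :
  (forall i j, measurable_fun setT (fun w => M w i j)) -> continuous f ->
  measurable_fun setT (fun w => f (M w)).
Proof.
move=> mM cf; apply: (measurability (@RGenOpens.G R)).
  exact: RGenOpens.measurableE.
move=> _ [_ [x [y ->]] <-]; rewrite setTI.
apply: (measurable_entrywise_open mM (O := f @^-1` `]x, y[)).
by apply: open_comp => // A _; exact: cf.
Qed.

End MeasurableMatrix.

(** * Conditional bounds without conditional expectations *)

Section ConditionalBound.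
Context {d : measure_display} {T : measurableType d} {R : realType}.
Variable P : probability T R.
Local Open Scope ereal_scope.

(** Measurability for the sigma-algebra generated by [G], phrased as
   measurability on the type that carries it, so that the closure properties of
   measurable functions apply. *)
Definition wrt (G : set (set T)) (Z : T -> R) : Prop :=
  measurable_fun setT (Z : g_sigma_algebraType G -> R).

(** The content of E(W | G) <= c: integrating against any nonnegative variable
   that is measurable for the sigma-algebra generated by [G]. *)
Definition cond_exp_le (G : set (set T)) (W : T -> \bar R) (c : R) : Prop :=
  forall Z : T -> R, (forall w, (0 <= Z w)%R) -> wrt G Z ->
    \int[P]_w ((Z w)%:E * W w) <= c%:E * \int[P]_w (Z w)%:E.

Lemma wrt_measurable (G : set (set T)) (Z : T -> R) :
  <<s G >> `<=` measurable -> wrt G Z -> measurable_fun setT (EFin \o Z).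
Proof. by move=> sG mZ; apply/measurable_EFinP => _ B mB; apply: sG; exact: mZ. Qed.

(** Both sides are integrals of [Z] for measures on the sub-sigma-algebra, and
   the hypothesis compares these measures set by set. *)
Lemma restricted_integral_le (G : set (set T)) (A : set T) (q : R) (Z : T -> R) :
  <<s G >> `<=` measurable -> measurable A -> (0 <= q)%R ->
  (forall B, <<s G >> B -> P (A `&` B) <= q%:E * P B) ->
  (forall w, (0 <= Z w)%R) -> wrt G Z ->
  \int[P]_(w in A) (Z w)%:E <= q%:E * \int[P]_w (Z w)%:E.
Proof.
move=> sG mA q0 AB Z0 mZ.
pose U := g_sigma_algebraType G; pose toU : T -> U := id.
have mtoU : measurable_fun setT toU by move=> _ B mB; rewrite setTI; exact: sG.
have mZT := wrt_measurable sG mZ.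
have mZU : measurable_fun setT (EFin \o Z : U -> \bar R) by apply/measurable_EFinP.
have ZE0 w : 0 <= (EFin \o Z) w by rewrite lee_fin.
have := @ge0_le_measure_integral _ U R (pushforward (mrestr P mA) toU)
  (mscale (NngNum q0) (pushforward P toU)).
move=> /(_ mtoU mtoU) /(_ _ (EFin \o Z) setT measurableT ZE0 mZU).
rewrite ge0_integral_mscale// !ge0_integral_pushforward//=; last 2 first.
- by move=> w _; rewrite lee_fin.
- by move=> w _; rewrite lee_fin.
move=> le12.
apply: le_trans (le12 _); last first.
  by move=> B mB; rewrite /mscale /pushforward /mrestr /= setIC AB.
rewrite [leLHS](_ : _ = \int[mrestr P mA]_(w in A) (Z w)%:E).
  by apply: (@ge0_subset_integral _ _ _ (mrestr P mA) A setT mA measurableT _ mZT).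
apply: eq_measure_integral => B mB BA.
by rewrite /= /mrestr setIidl.
Qed.

Lemma cond_exp_le_indic (G : set (set T)) (A : set T) (q : R) :
  <<s G >> `<=` measurable -> measurable A -> (0 <= q)%R ->
  (forall B, <<s G >> B -> P (A `&` B) <= q%:E * P B) ->
  cond_exp_le G (fun w => (\1_A w)%:E) q.
Proof.
move=> sG mA q0 AB Z Z0 mZ; apply: le_trans (restricted_integral_le sG mA q0 AB Z0 mZ).
rewrite [leRHS]integral_mkcond le_eqVlt; apply/orP; left; apply/eqP.
apply: eq_integral => w _; rewrite patchE indicE.
by case: ifP => _; rewrite ?mule1 ?mule0.
Qed.

Lemma cond_exp_le_cst (G : set (set T)) (c : R) : (0 <= c)%R ->
  <<s G >> `<=` measurable -> cond_exp_le G (cst c%:E) c.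
Proof.
move=> c0 sG Z Z0 mZ; have mZT := wrt_measurable sG mZ.
rewrite -ge0_integralZl// ?lee_fin//; last by move=> w _; rewrite lee_fin.
by under eq_integral do rewrite muleC.
Qed.

Lemma cond_exp_leD (G : set (set T)) (W1 W2 : T -> \bar R) (c1 c2 : R) :
  <<s G >> `<=` measurable -> (0 <= c1)%R -> (0 <= c2)%R ->
  measurable_fun setT W1 -> measurable_fun setT W2 ->
  (forall w, 0 <= W1 w) -> (forall w, 0 <= W2 w) ->
  cond_exp_le G W1 c1 -> cond_exp_le G W2 c2 ->
  cond_exp_le G (fun w => W1 w + W2 w) (c1 + c2).
Proof.
move=> sG c10 c20 mW1 mW2 W10 W20 h1 h2 Z Z0 mZ; have mZT := wrt_measurable sG mZ.
have ZE0 w : 0 <= (Z w)%:E by rewrite lee_fin.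
under eq_integral do rewrite ge0_muleDr//.
rewrite ge0_integralD//; last 4 first.
- by move=> w _; rewrite mule_ge0.
- exact: emeasurable_funM.
- by move=> w _; rewrite mule_ge0.
- exact: emeasurable_funM.
by rewrite EFinD ge0_muleDl ?lee_fin//; apply: leeD; [exact: h1|exact: h2].
Qed.

Lemma cond_exp_leZ (G : set (set T)) (W : T -> \bar R) (k c : R) :
  <<s G >> `<=` measurable -> (0 <= k)%R ->
  measurable_fun setT W -> (forall w, 0 <= W w) ->
  cond_exp_le G W c -> cond_exp_le G (fun w => k%:E * W w) (k * c).
Proof.
move=> sG k0 mW W0 h Z Z0 mZ; have mZT := wrt_measurable sG mZ.
have ZE0 w : 0 <= (Z w)%:E by rewrite lee_fin.
under eq_integral do rewrite muleCA.
rewrite ge0_integralZl//; first by rewrite EFinM -muleA lee_wpmul2l// h.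
- exact: emeasurable_funM.
- by move=> w _; rewrite mule_ge0.
Qed.

Lemma cond_exp_le_mono (G : set (set T)) (W W' : T -> \bar R) (c c' : R) :
  <<s G >> `<=` measurable ->
  measurable_fun setT W -> measurable_fun setT W' ->
  (forall w, 0 <= W w) -> (forall w, W w <= W' w) -> (c' <= c)%R ->
  cond_exp_le G W' c' -> cond_exp_le G W c.
Proof.
move=> sG mW mW' W0 WW' cc' h Z Z0 mZ; have mZT := wrt_measurable sG mZ.
have ZE0 w : 0 <= (Z w)%:E by rewrite lee_fin.
have W'0 w : 0 <= W' w := le_trans (W0 w) (WW' w).
apply: (@le_trans _ _ (\int[P]_w ((Z w)%:E * W' w))).
  apply: ge0_le_integral => //.
  - by move=> w _; rewrite mule_ge0.
  - exact: emeasurable_funM.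
  - exact: emeasurable_funM.
  - by move=> w _; rewrite lee_wpmul2l.
apply: le_trans (h _ Z0 mZ) _; rewrite lee_wpmul2r ?lee_fin//.
exact: integral_ge0.
Qed.

(** Monotone convergence. *)
Lemma cond_exp_le_series (G : set (set T)) (W : nat -> T -> \bar R) (c : nat -> R) (C : R) :
  <<s G >> `<=` measurable -> (forall k, (0 <= c k)%R) ->
  (forall k, measurable_fun setT (W k)) -> (forall k w, 0 <= W k w) ->
  (forall k, cond_exp_le G (W k) (c k)) ->
  (forall n, (\sum_(k < n) c k <= C)%R) ->
  cond_exp_le G (fun w => \sum_(k <oo) W k w) C.
Proof.
move=> sG c0 mW W0 h cC Z Z0 mZ; have mZT := wrt_measurable sG mZ.
have ZE0 w : 0 <= (Z w)%:E by rewrite lee_fin.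
under eq_integral do rewrite -nneseriesZl//.
rewrite integral_nneseries//; last 2 first.
- by move=> n; exact: emeasurable_funM.
- by move=> n w _; rewrite mule_ge0.
apply: lime_le.
  by apply: is_cvg_nneseries => n _ _; apply: integral_ge0 => w _; rewrite mule_ge0.
apply: nearW => n; rewrite big_mkord.
apply: (@le_trans _ _ (\sum_(k < n) ((c k)%:E * \int[P]_w (Z w)%:E))).
  by apply: lee_sum => k _; exact: h.
rewrite -ge0_sume_distrl; last by move=> k _; rewrite lee_fin.
by rewrite sumEFin lee_wpmul2r ?lee_fin//; exact: integral_ge0.
Qed.

(** The supermartingale argument behind both concentration bounds: the product
   over the first [n] factors belongs to the past of the next one. *)
Lemma expectation_prod_le (G : nat -> set (set T)) (W : nat -> T -> R) (c : R) :
  (forall k, <<s G k >> `<=` measurable) -> (0 <= c)%R -> (forall k w, (0 <= W k w)%R) ->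
  (forall j k, (j < k)%N -> wrt (G k) (W j)) ->
  (forall k, cond_exp_le (G k) (EFin \o W k) c) ->
  forall n, \int[P]_w (\prod_(k < n) W k w)%:E <= (c ^+ n)%:E.
Proof.
move=> sG c0 W0 mW h; elim=> [|n IH].
  under eq_integral do rewrite big_ord0.
  by rewrite integral_cst// mul1e probability_le1.
under eq_integral do rewrite big_ord_recr/= EFinM.
apply: le_trans (h n (fun w => \prod_(k < n) W k w)%R _ _) _.
- by move=> w; rewrite prodr_ge0.
- by apply: measurable_prod => k _; exact: mW.
- by rewrite exprS EFinM lee_wpmul2l.
Qed.

Lemma markov_prob (X : T -> R) (S : set T) (b c : R) :
  measurable_fun setT X -> (forall w, (0 <= X w)%R) -> measurable S -> (0 < b)%R ->
  (forall w, S w -> (b <= X w)%R) -> \int[P]_w (X w)%:E <= c%:E ->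
  P S <= (c / b)%:E.
Proof.
move=> mX X0 mS b0 bX Xc; rewrite EFinM lee_pdivlMr// muleC.
have mXE : measurable_fun setT (EFin \o X) by apply/measurable_EFinP.
rewrite -(integral_cst P mS); apply: le_trans Xc.
apply: (@le_trans _ _ (\int[P]_(w in S) (X w)%:E)).
  apply: ge0_le_integral => //.
  - by move=> w _; rewrite lee_fin ltW.
  - exact: measurable_funTS.
by apply: ge0_subset_integral => // w _; rewrite lee_fin.
Qed.

End ConditionalBound.

(** * Two concentration bounds *)

Section ExpBounds.
Context {R : realType}.
Implicit Types x y p : R.

(** [k] has the sign of the derivative of [cosh x / exp (x^2 / 2)], and is itself
   decreasing. *)
Lemma cosh_le_gauss x : 0 <= x -> (expR x + expR (- x)) / 2 <= expR (x ^+ 2 / 2).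
Proof.
rewrite le_eqVlt => /predU1P[<-|x0].
  by rewrite oppr0 expr0n mul0r expR0; lra.
pose k y := (1 - y) * expR y - (1 + y) * expR (- y).
have dk y : is_derive y (1 : R) k (- (y * (expR y - expR (- y)))).
  by apply: is_derive_eq; rewrite /GRing.scale /=; ring.
have k_le0 y : 0 <= y -> k y <= 0.
  rewrite le_eqVlt => /predU1P[<-|y0].
    by rewrite /k oppr0 expR0; lra.
  have [c /andP[c0 cy] E] := mean_value y0 dk.
  have : 0 <= c * (expR c - expR (- c)).
    by rewrite mulr_ge0// subr_ge0 ler_expR; lra.
  have k00 : k 0 = 0 by rewrite /k oppr0 expR0; ring.
  by move: E; rewrite k00 subr0 => -> h; rewrite pmulr_lle0//; lra.
pose g y := (expR y + expR (- y)) * expR (- (y ^+ 2 / 2)).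
have dg y : is_derive y (1 : R) g (k y * expR (- (y ^+ 2 / 2))).
  by apply: is_derive_eq; rewrite /GRing.scale /= /k; field.
have [c /andP[c0 cx] E] := mean_value x0 dg.
have : g x <= g 0.
  by rewrite -subr_le0 E pmulr_lle0// pmulr_lle0 ?expR_gt0// k_le0.
rewrite /g expr0n mul0r !oppr0 expR0 mulr1 [expR (- (_ / 2))]expRN.
by rewrite ler_pdivrMr ?expR_gt0// => h; rewrite ler_pdivrMr// mulrC.
Qed.

(** The graph of [exp] lies above its tangent at [s x + (1 - s) y]. *)
Lemma expR_convex s x y : 0 <= s <= 1 ->
  expR (s * x + (1 - s) * y) <= s * expR x + (1 - s) * expR y.
Proof.
move=> /andP[s0 s1]; set z := s * x + _.
have tangent u : expR z * (1 + (u - z)) <= expR u.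
  have -> : expR u = expR z * expR (u - z) by rewrite -expRD addrC subrK.
  by rewrite ler_wpM2l ?expR_ge0 ?expR_ge1Dx.
have h1 := ler_wpM2l s0 (tangent x).
have h2 : (1 - s) * (expR z * (1 + (y - z))) <= (1 - s) * expR y.
  by rewrite ler_wpM2l ?subr_ge0.
apply: le_trans (lerD h1 h2); rewrite le_eqVlt; apply/orP; left; apply/eqP.
by rewrite /z; ring.
Qed.

(** The normalised deviation [1 - b / p] of a Bernoulli variable [b] of mean [p]
   is centred and, as [1/2 <= p], has values in [[-1, 1]]; by convexity its
   exponential moments are at most those of a random sign. *)
Lemma bernoulli_mgf p x : 2^-1 <= p <= 1 -> 0 <= x ->
  p * expR (x * (1 - p^-1)) + (1 - p) * expR x <= expR (x ^+ 2 / 2).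
Proof.
move=> /andP[p2 p1] x0; apply: le_trans (cosh_le_gauss x0).
have p0 : 0 < p by lra.
pose s := 1 - (2 * p)^-1.
have ps : p * s = p - 2^-1 by rewrite /s; field; rewrite gt_eqF.
have s01 : 0 <= s <= 1.
  by apply/andP; split; [rewrite -(pmulr_rge0 s p0) ps|rewrite -(ler_pM2l p0) ps]; lra.
have := expR_convex x (- x) s01.
have -> : s * x + (1 - s) * (- x) = x * (1 - p^-1) by rewrite /s; field; rewrite gt_eqF.
move=> /(ler_wpM2l (ltW p0)).
have -> : p * (s * expR x + (1 - s) * expR (- x)) =
    p * s * expR x + (p - p * s) * expR (- x) by ring.
by rewrite ps; lra.
Qed.

End ExpBounds.

Section MeasurableSets.
Context {d : measure_display} {S : measurableType d} {R : realType}.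

Lemma measurable_bool_set (b : S -> bool) :
  measurable_fun setT b -> measurable [set w | b w].
Proof. by move=> mb; rewrite -[X in measurable X]setTI; exact: (mb measurableT [set true]). Qed.

Lemma bool_set_measurable (b : S -> bool) :
  measurable [set w | b w] -> measurable_fun setT b.
Proof.
by move=> mb; apply: (@measurable_fun_bool _ S setT b true); rewrite setTI.
Qed.

Lemma measurable_set_le (f g : S -> R) :
  measurable_fun setT f -> measurable_fun setT g -> measurable [set w | f w <= g w].
Proof. by move=> mf mg; apply: measurable_bool_set; exact: measurable_fun_ler. Qed.

Lemma measurable_set_lt (f g : S -> R) :
  measurable_fun setT f -> measurable_fun setT g -> measurable [set w | f w < g w].
Proof. by move=> mf mg; apply: measurable_bool_set; exact: measurable_fun_ltr. Qed.

Lemma measurable_if (b : S -> bool) (f g : S -> R) : measurable [set w | b w] ->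
  measurable_fun setT f -> measurable_fun setT g ->
  measurable_fun setT (fun w => if b w then f w else g w).
Proof. by move=> /bool_set_measurable mb mf mg; exact: measurable_fun_ifT. Qed.

Lemma measurable_count (b : nat -> S -> bool) (N : nat) :
  (forall k, measurable [set w | b k w]) ->
  measurable_fun setT (fun w => (\sum_(k < N) b k w)%N%:R : R).
Proof.
move=> mb; rewrite (_ : (fun w => _) = fun w => \sum_(k < N) (if b k w then 1 else 0)).
  by apply: measurable_sum => k; apply: measurable_if => //; exact: measurable_cst.
by apply/funext => w; rewrite natr_sum; apply: eq_bigr => k _; case: (b k w).
Qed.

End MeasurableSets.

Section Concentration.
Context {d : measure_display} {T : measurableType d} {R : realType}.
Variable P : probability T R.

(** Azuma-Hoeffding for the sum of the normalised deviations [1 - b_k / p]; the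
   optimal exponential parameter is the deviation per step that is to be
   excluded, [theta = 1 - phat / p]. *)
Lemma count_concentration (G : nat -> set (set T)) (b : nat -> T -> bool) (p phat : R) (N : nat) :
  (forall k, <<s G k >> `<=` measurable) ->
  (forall k, measurable [set w | b k w]) ->
  (forall j k, (j < k)%N -> <<s G k >> [set w | b j w]) ->
  (forall k B, <<s G k >> B -> (P (~` [set w | b k w] `&` B) <= (1 - p)%:E * P B)%E) ->
  2^-1 <= p <= 1 -> phat <= p ->
  (P [set w | ((\sum_(k < N) b k w)%N%:R <= phat * N%:R)%R]
    <= (expR (- ((1 - phat / p) ^+ 2 / 2 * N%:R)))%:E)%E.
Proof.
move=> sG mb bG bP p01 php; have /andP[p2 p1] := p01; have p0 : 0 < p by lra.
pose th := 1 - phat / p.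
have th0 : 0 <= th by rewrite subr_ge0 ler_pdivrMr// mul1r.
pose W k w := expR (th * (1 - (b k w)%:R / p)).
pose lo := expR (th * (1 - p^-1)); pose hi := expR th.
have lohi : lo <= hi.
  by rewrite ler_expR ler_piMr// lerBlDr lerDl invr_ge0 ltW.
(* The two values of [W k], on the event [b k] and off it. *)
have WE k w : W k w = if b k w then lo else hi.
  by rewrite /W; case: ifP => _; rewrite ?mul1r// mul0r subr0 mulr1.
have mW k : measurable_fun setT (W k).
  rewrite (_ : W k = fun w => if b k w then lo else hi); last exact/funext/WE.
  by apply: measurable_if => //; exact: measurable_cst.
have h k : cond_exp_le P (G k) (EFin \o W k) (lo + (hi - lo) * (1 - p)).
  have mbc : measurable (~` [set w | b k w]) by apply: measurableC.
  rewrite (_ : EFin \o W k = fun w =>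
      (cst lo%:E w + (hi - lo)%:E * (\1_(~` [set w | b k w]) w)%:E)%E); last first.
    apply/funext => w /=; rewrite -EFinM -EFinD WE indicE; congr EFin.
    case: (boolP (b k w)) => bw.
      by rewrite memNset ?mulr0 ?addr0//= => /(_ bw).
    by rewrite mem_set ?mulr1 1?addrC ?subrK//=; apply/negP.
  apply: cond_exp_leD => //.
  - exact: expR_ge0.
  - by rewrite mulr_ge0 ?subr_ge0.
  - apply: measurable_funeM; apply/measurable_EFinP; exact: measurable_indic.
  - by move=> w; rewrite lee_fin expR_ge0.
  - by move=> w; rewrite -EFinM lee_fin mulr_ge0 ?subr_ge0.
  - exact: cond_exp_le_cst (expR_ge0 _) (sG k).
  apply: cond_exp_leZ => //; first by rewrite subr_ge0.
  - by apply/measurable_EFinP; exact: measurable_indic.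
  by apply: cond_exp_le_indic => //; [rewrite subr_ge0|exact: bP].
pose c := lo + (hi - lo) * (1 - p).
have c0 : 0 <= c by rewrite addr_ge0 ?expR_ge0// mulr_ge0 ?subr_ge0.
have c_le : c <= expR (th ^+ 2 / 2).
  by apply: le_trans (bernoulli_mgf p01 th0); rewrite /c /lo /hi; lra.
have W0 k w : 0 <= W k w by exact: expR_ge0.
have bound := expectation_prod_le sG c0 W0 _ h N.
have prodE w : \prod_(k < N) W k w = expR (th * (N%:R - (\sum_(k < N) b k w)%N%:R / p)).
  rewrite -expR_sum -mulr_sumr; congr (expR (_ * _)).
  rewrite big_split/= sumr_const card_ord sumrN -mulr_suml natr_sum.
  by [].
have -> : expR (- (th ^+ 2 / 2 * N%:R)) =
    expR (th ^+ 2 / 2) ^+ N / expR (th * (N%:R * th)).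
  by rewrite -expRM_natr -expRN -expRD; congr expR; rewrite -mulr_natr; field.
apply: (markov_prob (X := fun w => \prod_(k < N) W k w)).
- by apply: measurable_prod => k _.
- by move=> w; rewrite prodr_ge0.
- by apply: measurable_set_le => //; exact: measurable_count.
- exact: expR_gt0.
- move=> w /= Sw; rewrite prodE ler_expR ler_wpM2l// mulrBr mulr1 lerB//.
  by rewrite ler_pdivrMr// -mulrA divfK ?gt_eqF// mulrC.
- apply: le_trans (bound _) _.
    move=> j k jk; rewrite (_ : W j = fun w => if b j w then lo else hi); last exact/funext/WE.
    apply: (@measurable_if _ (g_sigma_algebraType (G k))) => //; exact: bG.
  by rewrite lee_fin lerXn2r ?nnegrE ?expR_ge0.
Qed.

End Concentration.

Section SubexponentialNoise.
Context {d : measure_display} {T : measurableType d} {R : realType}.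
Variable P : probability T R.

Local Notation u := (expR 2^-1 : R).

(** That is, [sqrt e] exceeds the golden ratio 1.618; already
   [(1 + 1/16)^8 > 1.624]. *)
Lemma sqrt_e_golden : 1 + u <= expR 1.
Proof.
have -> : expR 1 = u ^+ 2 :> R by rewrite -expRM_natl; congr expR; field.
have h : 1 + 16^-1 <= expR 16^-1 :> R by exact: expR_ge1Dx.
have e8 : u = expR 16^-1 ^+ 8 by rewrite -expRM_natl; congr expR; field.
have : (1 + 16^-1) ^+ 8 <= u by rewrite e8 lerXn2r// ?nnegrE ?expR_ge0//; lra.
move: (u) => v hv; have : 1624 / 1000 <= v by apply: le_trans hv; lra.
by nra.
Qed.

(** A layer-cake formula discretised with mesh 1/2, which replaces the
   integration over all levels by a series. *)
Lemma expR_le_layers (v : R) (n : nat) : v <= n%:R / 2 ->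
  expR v <= 1 + \sum_(j < n) (u ^+ j.+1 - u ^+ j) * (j%:R / 2 < v)%R%:R.
Proof.
have u1 : 1 <= u by rewrite -expR0 ler_expR invr_ge0.
elim: n => [|n IH] vn.
  by rewrite big_ord0 addr0 -expR0 ler_expR; move: vn; rewrite mul0r.
have inc j : 0 <= u ^+ j.+1 - u ^+ j.
  by rewrite subr_ge0 exprS ler_peMl// exprn_ge0// expR_ge0.
rewrite big_ord_recr /=; have [le|lt] := leP v (n%:R / 2).
  by rewrite mulr0 addr0 IH.
have full m : (m <= n.+1)%N ->
    \sum_(j < m) (u ^+ j.+1 - u ^+ j) * (j%:R / 2 < v)%R%:R = u ^+ m - 1.
  elim: m => [|m IHm] mn; first by rewrite big_ord0 expr0 subrr.
  rewrite big_ord_recr /= IHm 1?ltnW// (_ : (m%:R / 2 < v)) ?mulr1; first by ring.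
  by apply: le_lt_trans lt; rewrite ler_wpM2r ?invr_ge0// ler_nat.
have := full n.+1 (leqnn _); rewrite big_ord_recr /= lt => ->.
rewrite subrKC -expRM_natr ler_expR; apply: le_trans vn _.
by rewrite mulrC.
Qed.

(** The layer at height [j / 2] has measure at most [exp (- j)], so that the
   layers add up to a geometric series: in total [1 + sqrt e], which is at most
   [e]. *)
Lemma cond_exp_le_expR (G : set (set T)) (E : T -> R) (a epsf : R) :
  <<s G >> `<=` measurable -> measurable_fun setT E -> 0 < a -> 0 <= epsf ->
  (forall t : R, 0 <= t -> forall B, <<s G >> B ->
    (P ([set w | (t < E w)%R] `&` B) <= (expR (a * (epsf - t))%R)%:E * P B)%E) ->
  cond_exp_le P G (fun w => (expR (a / 2 * (E w - epsf)))%:E) (expR 1).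
Proof.
move=> sG mE a0 e0 tail.
have u1 : 1 <= u by rewrite -expR0 ler_expR invr_ge0.
have u0 : 0 < u := expR_gt0 _.
have inc j : 0 <= u ^+ j.+1 - u ^+ j.
  by rewrite subr_ge0 exprS ler_peMl// exprn_ge0// expR_ge0.
pose A j := [set w | epsf + j%:R / a < E w].
have mA j : measurable (A j) by apply: measurable_set_lt => //; exact: measurable_cst.
have mI j : measurable_fun setT (fun w => (\1_(A j) w)%:E : \bar R).
  by apply/measurable_EFinP; exact: measurable_indic.
pose W (j : nat) w := ((u ^+ j.+1 - u ^+ j)%:E * (\1_(A j) w)%:E)%E.
have mW j : measurable_fun setT (W j) by exact: measurable_funeM.
have W0 j w : (0 <= W j w)%E by rewrite /W -EFinM lee_fin mulr_ge0.
pose c (j : nat) := (u ^+ j.+1 - u ^+ j) * expR (- j%:R).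
have hW j : cond_exp_le P G (W j) (c j).
  apply: cond_exp_leZ => //.
  apply: cond_exp_le_indic => //.
  move=> B GB; have := tail (epsf + j%:R / a) _ B GB.
  have -> : a * (epsf - (epsf + j%:R / a)) = - j%:R by field; rewrite gt_eqF.
  by apply; rewrite addr_ge0// divr_ge0// ltW.
have csum n : \sum_(j < n) c j = u - u / u ^+ n.
  elim: n => [|n IH]; first by rewrite big_ord0 expr0 divr1 subrr.
  rewrite big_ord_recr /= IH /c.
  have -> : expR (- n%:R) = (u ^+ n * u ^+ n)^-1 :> R.
    by rewrite expRN -exprD -expRM_natl addnn -mul2n natrM; congr ((expR _)^-1); field.
  rewrite !exprS; field; rewrite !expf_neq0 ?gt_eqF//.
have hS : cond_exp_le P G (fun w => \sum_(j <oo) W j w)%E u.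
  apply: (cond_exp_le_series sG _ mW W0 hW) => [j|n].
    by rewrite mulr_ge0 ?expR_ge0.
  by rewrite csum lerBlDr lerDl divr_ge0 ?exprn_ge0 ?expR_ge0.
have mS : measurable_fun setT (fun w => \sum_(j <oo) W j w)%E.
  by apply: ge0_emeasurable_sum => // j w _ _; exact: W0.
have S0 w : (0 <= \sum_(j <oo) W j w)%E by apply: nneseries_ge0 => j _ _; exact: W0.
have h1S : cond_exp_le P G (fun w => cst 1%:E w + \sum_(j <oo) W j w)%E (1 + u).
  apply: cond_exp_leD => //.
  exact: cond_exp_le_cst ler01 sG.
apply: cond_exp_le_mono h1S => //.
- apply/measurable_EFinP; apply: measurableT_comp; first exact: measurable_expR.
  by apply: measurable_funM => //; apply: measurable_funB.
- by apply: emeasurable_funD.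
- move=> w; set v := a / 2 * (E w - epsf).
  have [n vn] : exists n : nat, v <= n%:R / 2.
    exists (Num.bound `|v * 2|); rewrite ler_pdivlMr//.
    exact: ltW (le_lt_trans (ler_norm _) (archi_boundP (normr_ge0 _))).
  apply: (@le_trans _ _ (1 + \sum_(j < n) W j w)%E); last first.
    by apply: leeD => //; rewrite -(big_mkord xpredT (fun j => W j w)); apply: nneseries_lim_ge => j _ _; exact: W0.
  rewrite /W; under eq_bigr do rewrite -EFinM.
  rewrite sumEFin -EFinD lee_fin; apply: le_trans (expR_le_layers vn) _.
  rewrite lerD2l; apply: ler_sum => j _; rewrite ler_wpM2l// indicE.
  suff -> : (w \in A j) = (j%:R / 2 < v) by [].
  rewrite (_ : (w \in A j) = (epsf + j%:R / a < E w)); last first.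
    by apply/idP/idP => [/set_mem|/mem_set].
  have a2 : 0 < a / 2 by rewrite divr_gt0.
  rewrite -ltrBrDl -[in LHS](ltr_pM2l a2) /v; congr (_ < _).
  by field; rewrite gt_eqF.
- exact: sqrt_e_golden.
Qed.

(** A Chernoff bound with parameter [a / 4], for which the product of the two
   exponentials of an iteration is at most the mean of their squares, whatever
   the dependence between the two errors; the allowance [4 / a] per iteration
   in the sum pays for the factor [e] per iteration in the expectation. *)
Lemma noise_concentration (G : nat -> set (set T)) (E E' : nat -> T -> R) (a epsf t : R) (N : nat) :
  (forall k, <<s G k >> `<=` measurable) -> 0 < a -> 0 <= epsf ->
  (forall k, measurable_fun setT (E k)) -> (forall k, measurable_fun setT (E' k)) ->
  (forall j k, (j < k)%N -> wrt (G k) (E j)) ->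
  (forall j k, (j < k)%N -> wrt (G k) (E' j)) ->
  (forall k (s : R), 0 <= s -> forall B, <<s G k >> B ->
    (P ([set w | (s < E k w)%R] `&` B) <= (expR (a * (epsf - s))%R)%:E * P B)%E) ->
  (forall k (s : R), 0 <= s -> forall B, <<s G k >> B ->
    (P ([set w | (s < E' k w)%R] `&` B) <= (expR (a * (epsf - s))%R)%:E * P B)%E) ->
  (P [set w | (N%:R * (2 * epsf + 4 / a) + t <= \sum_(k < N) (E k w + E' k w))%R]
    <= (expR (- (a / 4 * t)))%:E)%E.
Proof.
move=> sG a0 e0 mE mE' wE wE' tE tE'.
pose W k w := expR (a / 4 * (E k w + E' k w) - a / 2 * epsf).
have mEE k : measurable_fun setT (fun w => E k w + E' k w) by exact: measurable_funD.
have affine (d' : measure_display) (S : measurableType d') (X Y : S -> R) :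
    measurable_fun setT X -> measurable_fun setT Y ->
    measurable_fun setT (fun w => expR (a / 4 * (X w + Y w) - a / 2 * epsf)).
  move=> mX mY; apply: measurableT_comp; first exact: measurable_expR.
  apply: measurable_funB => //; apply: measurable_funM => //; exact: measurable_funD.
have mexp (X : T -> R) : measurable_fun setT X ->
    measurable_fun setT (fun w : T => (expR (a / 2 * (X w - epsf)))%:E).
  move=> mX; apply/measurable_EFinP; apply: measurableT_comp; first exact: measurable_expR.
  by apply: measurable_funM => //; apply: measurable_funB.
have h k : cond_exp_le P (G k) (EFin \o W k) (expR 1).
  have h1 := cond_exp_le_expR (sG k) (mE k) a0 e0 (tE k).
  have h2 := cond_exp_le_expR (sG k) (mE' k) a0 e0 (tE' k).
  have h10 : 0 <= 2^-1 :> R by rewrite invr_ge0.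
  have e1 : 0 <= expR 1 :> R := expR_ge0 _.
  have k1 := cond_exp_leZ (sG k) h10 (mexp _ (mE k)) (fun w => expR_ge0 _) h1.
  have k2 := cond_exp_leZ (sG k) h10 (mexp _ (mE' k)) (fun w => expR_ge0 _) h2.
  have hp : 0 <= 2^-1 * expR 1 :> R by rewrite mulr_ge0.
  have := cond_exp_leD (sG k) hp hp _ _ _ _ k1 k2.
  have sum1 : 2^-1 * expR 1 + 2^-1 * expR 1 = expR 1 :> R by field.
  rewrite sum1 => h3; apply: (cond_exp_le_mono (sG k) _ _ _ _ (lexx _) (h3 _ _ _ _)) => //.
  - by apply/measurable_EFinP; exact: affine.
  - by apply: emeasurable_funD; apply: measurable_funeM; exact: mexp.
  - by move=> w; rewrite lee_fin expR_ge0.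
  - move=> w; rewrite -!EFinM -EFinD lee_fin /W.
    have := @expR_convex R 2^-1 (a / 2 * (E k w - epsf)) (a / 2 * (E' k w - epsf)).
    have -> : 2^-1 * (a / 2 * (E k w - epsf)) + (1 - 2^-1) * (a / 2 * (E' k w - epsf)) =
      a / 4 * (E k w + E' k w) - a / 2 * epsf by field.
    have -> : 1 - 2^-1 = 2^-1 :> R by field.
    by apply; apply/andP; split; lra.
  - by apply: measurable_funeM; exact: mexp.
  - by apply: measurable_funeM; exact: mexp.
have W0 k w : 0 <= W k w by exact: expR_ge0.
have bound := expectation_prod_le sG (expR_ge0 1) W0 _ h N.
have prodE w : \prod_(k < N) W k w =
    expR (a / 4 * (\sum_(k < N) (E k w + E' k w)) - N%:R * (a / 2 * epsf)).
  rewrite -expR_sum big_split/= sumrN -mulr_sumr sumr_const card_ord.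
  by congr (expR (_ - _)); rewrite mulr_natl.
have -> : expR (- (a / 4 * t)) = expR 1 ^+ N / expR (N%:R + a / 4 * t).
  by rewrite -expRM_natl mulr1 -expRN -expRD; congr expR; ring.
apply: (markov_prob (X := fun w => \prod_(k < N) W k w)).
- by apply: measurable_prod => k _; exact: affine.
- by move=> w; rewrite prodr_ge0.
- by apply: measurable_set_le; [exact: measurable_cst|exact: measurable_sum].
- exact: expR_gt0.
- move=> w /= Sw; rewrite prodE ler_expR.
  have a4 : 0 <= a / 4 by rewrite divr_ge0// ltW.
  have := ler_wpM2l a4 Sw.
  have -> : a / 4 * (N%:R * (2 * epsf + 4 / a) + t) =
    N%:R * (a / 2 * epsf) + N%:R + a / 4 * t by field; rewrite gt_eqF.
  lra.
- apply: bound => j k jk.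
  exact: (affine _ (g_sigma_algebraType (G k)) (E j) (E' j) (wE _ _ jk) (wE' _ _ jk)).
Qed.

End SubexponentialNoise.

(** * Conditional probabilities, event by event *)

Section ConditionalProbabilityBounds.
Context {d : measure_display} {T : measurableType d} {R : realType}.
Variable P : probability T R.
Local Open Scope ereal_scope.

(** A version of a conditional probability is only almost surely bounded, and
   may be negative on a null set. *)
Lemma ae_integral_ge0 (B : set T) (f : T -> R) : measurable B ->
  measurable_fun setT f -> {ae P, forall w, (0 <= f w)%R} ->
  0 <= \int[P]_(w in B) (f w)%:E.
Proof.
move=> mB mf f0.
have -> : \int[P]_(w in B) (f w)%:E = \int[P]_(w in B) (Num.max (f w) 0)%:E.
  apply: ae_eq_integral => //.
  - by apply: measurable_funTS; apply/measurable_EFinP.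
  - by apply: measurable_funTS; apply/measurable_EFinP; exact: measurable_maxr.
  - by apply: filterS f0 => w fw _; rewrite (max_idPl fw).
by apply: integral_ge0 => w _; rewrite lee_fin le_max lexx orbT.
Qed.

(** Integrate [Y - p] over [B]. *)
Lemma cond_prob_geP (G : set (set T)) (A : set T) (p : R) :
  <<s G >> `<=` measurable -> cond_prob_ge P <<s G >> A p ->
  forall B, <<s G >> B -> p%:E * P B <= P (A `&` B).
Proof.
move=> sG [Y [_ iY YA] pY] B GB; have mB := sG _ GB.
rewrite -YA// -integral_cst// -sube_ge0; last first.
  by rewrite integral_cst// fin_numM// fin_num_measure.
have iYB : P.-integrable B (EFin \o Y) by exact: integrableS iY.
rewrite -integralB//; last exact: finite_measure_integrable_cst.
under eq_integral do rewrite -EFinB.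
apply: ae_integral_ge0 => //.
  by apply: measurable_funB => //; have /integrableP[/measurable_EFinP] := iY.
by apply: filterS pY => w; rewrite subr_ge0.
Qed.

Lemma cond_prob_leP (G : set (set T)) (A : set T) (q : R) :
  <<s G >> `<=` measurable -> cond_prob_le P <<s G >> A q ->
  forall B, <<s G >> B -> P (A `&` B) <= q%:E * P B.
Proof.
move=> sG [Y [_ iY YA] Yq] B GB; have mB := sG _ GB.
have iYB : P.-integrable B (EFin \o Y) by exact: integrableS iY.
rewrite -YA// -integral_cst// -sube_ge0; last first.
  by rewrite (integrable_fin_num mB iYB).
rewrite -integralB//; last exact: finite_measure_integrable_cst.
under eq_integral do rewrite -EFinB.
apply: ae_integral_ge0 => //.
  by apply: measurable_funB => //; have /integrableP[/measurable_EFinP] := iY.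
by apply: filterS Yq => w; rewrite subr_ge0.
Qed.

Lemma cond_prob_compl (G : set (set T)) (A : set T) (p : R) :
  <<s G >> `<=` measurable -> measurable A ->
  (forall B, <<s G >> B -> p%:E * P B <= P (A `&` B)) ->
  forall B, <<s G >> B -> P (~` A `&` B) <= (1 - p)%:E * P B.
Proof.
move=> sG mA AB B GB; have mB := sG _ GB.
rewrite setIC -setDE EFinB muleBl ?fin_num_measure// mul1e.
rewrite measureD// ?leeB ?fin_num_measure//; last by rewrite ltey_eq fin_num_measure.
by rewrite setIC AB.
Qed.

End ConditionalProbabilityBounds.

(** * Measurability of the run *)

Section MatrixMeasurability.
Context {d : measure_display} {S : measurableType d} {R : realType}.

Definition mx_measurable (m p : nat) (M : S -> 'M[R]_(m, p)) : Prop :=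
  forall i j, measurable_fun setT (fun w => M w i j).

Lemma mx_measurableD (m p : nat) (M N : S -> 'M[R]_(m, p)) :
  mx_measurable M -> mx_measurable N -> mx_measurable (fun w => M w + N w).
Proof.
move=> mM mN i j; under eq_fun do rewrite mxE.
by apply: measurable_funD; [exact: mM|exact: mN].
Qed.

Lemma mx_measurableB (m p : nat) (M N : S -> 'M[R]_(m, p)) :
  mx_measurable M -> mx_measurable N -> mx_measurable (fun w => M w - N w).
Proof.
move=> mM mN i j; under eq_fun do rewrite !mxE.
by apply: measurable_funB; [exact: mM|exact: mN].
Qed.

Lemma mx_measurableM (m p q : nat) (M : S -> 'M[R]_(m, p)) (N : S -> 'M[R]_(p, q)) :
  mx_measurable M -> mx_measurable N -> mx_measurable (fun w => M w *m N w).
Proof.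
move=> mM mN i j; under eq_fun do rewrite mxE.
by apply: measurable_sum => k; apply: measurable_funM; [exact: mM|exact: mN].
Qed.

Lemma mx_measurable_if (m p : nat) (b : S -> bool) (M N : S -> 'M[R]_(m, p)) :
  measurable [set w | b w] -> mx_measurable M -> mx_measurable N ->
  mx_measurable (fun w => if b w then M w else N w).
Proof.
move=> mb mM mN i j.
rewrite (_ : (fun w => _) = fun w => if b w then M w i j else N w i j).
  by apply: measurable_if .
by apply/funext => w; case: (b w).
Qed.

Lemma measurable_dotv (n : nat) (u v : S -> 'rV[R]_n) :
  mx_measurable u -> mx_measurable v -> measurable_fun setT (fun w => dotv (u w) (v w)).
Proof.
by move=> mu mv; apply: measurable_sum => k; apply: measurable_funM; [exact: mu|exact: mv].
Qed.

Lemma measurable_enorm (n : nat) (u : S -> 'rV[R]_n) :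
  mx_measurable u -> measurable_fun setT (fun w => enorm (u w)).
Proof. by move=> mu; apply: measurable_cts_entrywise mu _; exact: enorm_cts. Qed.

Lemma measurable_spec_norm (n : nat) (M : S -> 'M[R]_n) :
  mx_measurable M -> measurable_fun setT (fun w => spec_norm (M w)).
Proof. by move=> mM; apply: measurable_cts_entrywise mM _; exact: spec_norm_cts. Qed.

(** A symmetric matrix is its own symmetrisation, on which [lambda_min] is
   continuous. *)
Lemma measurable_lambda_min (n : nat) (M : S -> 'M[R]_n) : (0 < n)%N ->
  (forall w, (M w)^T = M w) -> mx_measurable M ->
  measurable_fun setT (fun w => lambda_min (M w)).
Proof.
move=> n0 symM mM.
rewrite (_ : (fun w => _) = fun w => lambda_min (2^-1 *: (M w + (M w)^T))).
  apply: (measurable_cts_entrywise (f := fun A => lambda_min (2^-1 *: (A + A^T))) mM).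
  exact: lambda_min_sym_cts.
apply/funext => w; rewrite symM scalerDr -scalerDl.
have -> : 2^-1 + 2^-1 = 1 :> R by field.
by rewrite scale1r.
Qed.

Section SmoothFunction.
Variables (n : nat) (phi : 'rV[R]_n -> R).
Hypothesis phi2 : twice_cont_diff phi.
Variable x : S -> 'rV[R]_n.
Hypothesis mx : mx_measurable x.

Lemma measurable_phi : measurable_fun setT (fun w => phi (x w)).
Proof.
have [dphi _ _] := phi2; apply: measurable_cts_entrywise mx _ => y.
exact: differentiable_continuous.
Qed.

Lemma mx_measurable_grad : mx_measurable (fun w => grad phi (x w)).
Proof.
have [_ dgrad _] := phi2 => i j.
apply: (measurable_cts_entrywise (f := fun y => grad phi y i j) mx) => y.
apply: (continuous_comp (f := grad phi) (g := fun u : 'rV[R]_n => u i j)).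
  exact: differentiable_continuous.
exact: coord_continuous.
Qed.

Lemma mx_measurable_hess : mx_measurable (fun w => hess phi (x w)).
Proof.
have [_ _ chess] := phi2 => i j.
apply: (measurable_cts_entrywise (f := fun y => hess phi y i j) mx) => y.
apply: (continuous_comp (f := hess phi) (g := fun u : 'M[R]_n => u i j)).
  exact: chess.
exact: coord_continuous.
Qed.

End SmoothFunction.
End MatrixMeasurability.

Section RunMeasurability.
Context {R : realType} {n : nat} {d d0 d1 d2 : measure_display}.
Context {T : measurableType d} {Xi0 : measurableType d0}
        {Xi1 : measurableType d1} {Xi2 : measurableType d2}.
Variables (phi : 'rV[R]_n -> R).
Variables (orc : oracles R n Xi0 Xi1 Xi2) (pr : process R n T Xi0 Xi1 Xi2).
Variables (p1 p2 : R) (x0 : 'rV[R]_n) (delta0 eta1 eta2 gamma r kfod kbhm : R).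
Hypotheses (n_gt0 : (0 < n)%N) (kfod_gt0 : 0 < kfod) (delta0_gt0 : 0 < delta0)
  (gamma_gt0 : 0 < gamma).
Hypothesis run : runs_algorithm2 phi orc pr x0 delta0 eta1 eta2 gamma r p1 p2 kfod.
Hypothesis adapt : adapted orc pr p1 p2.

(** The families that generate [past] and [past'], named because measurability is
   expressed on the type that carries the generated sigma-algebra. *)
Definition past_gen k : set (set T) :=
  \bigcup_(j in [set j | (j < k)%N])
    (generated (rand0 pr j) `|` generated (rand0p pr j) `|`
     generated (rand1 pr j) `|` generated (rand2 pr j)).

Definition past'_gen k : set (set T) :=
  past pr k `|` generated (rand1 pr k) `|` generated (rand2 pr k).

Lemma past_gen_sub j k : (j <= k)%N -> past_gen j `<=` past_gen k.
Proof. by move=> jk A [i /= ij Ai]; exists i => //=; exact: leq_trans jk. Qed.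

Lemma past_sub j k : (j <= k)%N -> past pr j `<=` past pr k.
Proof. by move=> jk; apply: sub_sigma_algebra2; exact: past_gen_sub. Qed.

Lemma past_past' k : past pr k `<=` past' pr k.
Proof. by move=> A pA; apply: sub_gen_smallest; left; left. Qed.

Lemma past'_past k : past' pr k `<=` past pr k.+1.
Proof.
apply: smallest_sub; first exact: smallest_sigma_algebra.
move=> A [[pA|gA]|gA].
- exact: past_sub (leqnSn k) _ pA.
- by apply: sub_gen_smallest; exists k => //=; left; right.
- by apply: sub_gen_smallest; exists k => //=; right.
Qed.

Lemma past_measurable k : past pr k `<=` measurable.
Proof.
apply: smallest_sub; first exact: sigma_algebra_measurable.
by move=> A [i _ [[[[B mB <-]|[B mB <-]]|[B mB <-]]|[B mB <-]]];
  exact: measurable_funP.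
Qed.

Lemma past'_measurable k : past' pr k `<=` measurable.
Proof. by move=> A /past'_past; exact: past_measurable. Qed.

Lemma rv_wrtP (G : set (set T)) (Y : T -> R) : rv_wrt <<s G >> Y -> wrt G Y.
Proof. by move=> h _ B mB; apply: h; exists B. Qed.

Lemma wrt_sub (G G' : set (set T)) (Y : T -> R) :
  <<s G >> `<=` <<s G' >> -> wrt G Y -> wrt G' Y.
Proof. by move=> GG' mY _ B mB; apply: GG'; exact: mY. Qed.

Definition mxwrt (G : set (set T)) (m p : nat) (M : T -> 'M[R]_(m, p)) : Prop :=
  forall i j, wrt G (fun w => M w i j).

Lemma mxwrt_sub (G G' : set (set T)) (m p : nat) (M : T -> 'M[R]_(m, p)) :
  <<s G >> `<=` <<s G' >> -> mxwrt G M -> mxwrt G' M.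
Proof. by move=> GG' mM i j; apply: wrt_sub GG' _; exact: mM. Qed.

Lemma mx_wrtP (G : set (set T)) (m p : nat) (M : T -> 'M[R]_(m, p)) :
  mx_wrt <<s G >> M -> mxwrt G M.
Proof. by move=> h i j; exact: rv_wrtP. Qed.

Local Notation x := (iterate pr).
Local Notation s := (trial_step pr).
Local Notation delta := (Defs.radius pr).
Local Notation g := (Gk orc pr p1).
Local Notation H := (Hk orc pr p2).
Local Notation f := (Fk orc pr).
Local Notation fp := (Fplus orc pr).
Local Notation acc k w := (accepted phi eta1 r (x k w) (g k w) (H k w) (s k w) (f k w) (fp k w)).

Lemma run_radius_gt0 k w : 0 < delta k w.
Proof.
have [_ d_init step] := run; apply: (@radius_gt0 _ _ phi eta1 eta2 gamma r gamma_gt0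
  (x ^~ w) (g ^~ w) (s ^~ w) (H ^~ w) (delta ^~ w) (f ^~ w) (fp ^~ w)).
  by rewrite d_init.
by move=> j; have [] := step j w.
Qed.

(** The quotient in the acceptance test can be cleared, since the predicted
   decrease is nonnegative. *)
Lemma accE k w : acc k w =
  (0 < pred_decrease phi (x k w) (g k w) (H k w) (s k w)) &&
  (eta1 * pred_decrease phi (x k w) (g k w) (H k w) (s k w) <= f k w - fp k w + r).
Proof.
have [_ _ step] := run; have [adm _ _] := step k w.
have P0 := pred_decrease_ge0 kfod_gt0 (run_radius_gt0 k w) adm.
rewrite /accepted -subr_eq0 -/(pred_decrease _ _ _ _ _) lt_def P0 andbT.
by case: eqP => //= /eqP Pn; rewrite /rho ler_pdivlMr// lt_def Pn.
Qed.

Lemma wrt_pred_decrease k : mxwrt (past'_gen k) (g k) -> mxwrt (past'_gen k) (H k) ->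
  mxwrt (past'_gen k) (s k) ->
  wrt (past'_gen k) (fun w => pred_decrease phi (x k w) (g k w) (H k w) (s k w)).
Proof.
move=> mg mH ms; rewrite /wrt; under eq_fun do rewrite pred_decreaseE.
apply: measurableT_comp => //; apply: measurable_funD; first exact: measurable_dotv.
apply: measurable_funM => //; apply: measurable_dotv => //.
exact: mx_measurableM.
Qed.

(** The next iterate and radius are chosen by the acceptance test, which is
   decided by the oracle outputs of the current iteration. *)
Lemma run_measurable k : mxwrt (past_gen k) (x k) /\ wrt (past_gen k) (delta k).
Proof.
have [x_init d_init step] := run.
elim: k => [|k [mx md]].
  split=> [i j|]; rewrite /wrt.
    by under eq_fun do rewrite x_init; exact: measurable_cst.
  rewrite (_ : delta 0%N = cst delta0); last exact/funext.
  exact: measurable_cst.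
have [/mx_wrtP mg /mx_wrtP mH /mx_wrtP ms /rv_wrtP mf /rv_wrtP mfp] := adapt k.
have up := @past'_past k; have up0 := past_sub (leqnSn k).
have mP := wrt_sub up (wrt_pred_decrease mg mH ms).
have {}mx := mxwrt_sub up0 mx; have {}md := wrt_sub up0 md.
have {}mg := mxwrt_sub up mg; have {}mH := mxwrt_sub up mH.
have {}ms := mxwrt_sub up ms.
have macc : <<s past_gen k.+1 >> [set w | acc k w].
  rewrite (_ : [set w | acc k w] = [set w | (0 : R) < pred_decrease phi (x k w) (g k w) (H k w) (s k w)]
    `&` [set w | eta1 * pred_decrease phi (x k w) (g k w) (H k w) (s k w) <= f k w - fp k w + r]).
    apply: (@measurableI _ (g_sigma_algebraType (past_gen k.+1))).
      exact: measurable_set_lt.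
    apply: measurable_set_le; first exact: measurable_funM.
    by apply: measurable_funD => //; exact: measurable_funB.
  by apply/seteqP; split=> w /=; rewrite accE => /andP.
split.
  have mxs := mx_measurableD (S := g_sigma_algebraType (past_gen k.+1)) mx ms.
  have := @mx_measurable_if _ (g_sigma_algebraType (past_gen k.+1)) R _ _ _ _ _ macc mxs mx.
  rewrite (_ : (fun w => if acc k w then _ else _) = x k.+1)//.
  by apply/funext => w; have [_ -> _] := step k w.
pose up_test w := eta2 * delta k w <= beta_m (g k w) (H k w).
have mtest : <<s past_gen k.+1 >> [set w | acc k w && up_test w].
  rewrite (_ : [set w | _] = [set w | acc k w] `&` [set w | up_test w]).
    apply: (@measurableI _ (g_sigma_algebraType (past_gen k.+1))) => //.
    apply: measurable_set_le; first exact: measurable_funM.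
    apply: measurable_maxr; first exact: measurable_enorm.
    apply: measurableT_comp => //; apply: measurable_lambda_min => // w.
    exact: second_sym.
  by apply/seteqP; split=> w /= => [/andP|[-> ->]].
have := @measurable_if _ (g_sigma_algebraType (past_gen k.+1)) R _
  (fun w => gamma^-1 * delta k w) (fun w => gamma * delta k w) mtest
  (measurable_funM (measurable_cst _) md) (measurable_funM (measurable_cst _) md).
rewrite /wrt (_ : (fun w => if _ then _ else _) = delta k.+1)//.
by apply/funext => w; have [_ _ ->] := step k w.
Qed.

End RunMeasurability.

Section Events.
Context {R : realType} {n : nat} {d d0 d1 d2 : measure_display}.
Context {T : measurableType d} {Xi0 : measurableType d0}
        {Xi1 : measurableType d1} {Xi2 : measurableType d2}.
Variables (P : probability T R) (phi : 'rV[R]_n -> R) (L2 epsf a epsg keg epsH keh : R).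
Variables (orc : oracles R n Xi0 Xi1 Xi2) (pr : process R n T Xi0 Xi1 Xi2).
Variables (p1 p2 : R) (x0 : 'rV[R]_n) (delta0 eta1 eta2 gamma r kfod kbhm : R).
Hypotheses (n_gt0 : (0 < n)%N) (kfod_gt0 : 0 < kfod) (delta0_gt0 : 0 < delta0)
  (gamma_gt0 : 0 < gamma).
Hypotheses (phi2 : twice_cont_diff phi) (lipH : lipschitz_hessian phi L2).
Hypothesis run : runs_algorithm2 phi orc pr x0 delta0 eta1 eta2 gamma r p1 p2 kfod.
Hypothesis adapt : adapted orc pr p1 p2.

Local Notation x := (iterate pr).
Local Notation s := (trial_step pr).
Local Notation delta := (Defs.radius pr).
Local Notation g := (Gk orc pr p1).
Local Notation H := (Hk orc pr p2).
Local Notation f := (Fk orc pr).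
Local Notation fp := (Fplus orc pr).
Local Notation U k := (g_sigma_algebraType (past_gen pr k)).
Local Notation U' k := (g_sigma_algebraType (past'_gen pr k)).

Let runM := run_measurable n_gt0 kfod_gt0 delta0_gt0 gamma_gt0 run adapt.

Definition accurate_at k w : bool :=
  accurate phi epsg keg epsH keh (x ^~ w) (g ^~ w) (H ^~ w) (delta ^~ w) k.

Definition low_noise_at k w : bool :=
  low_noise phi epsg r (x ^~ w) (s ^~ w) (f ^~ w) (fp ^~ w) k.

Lemma accurate_measurable k : past' pr k [set w | accurate_at k w].
Proof.
have [mx md] := runM k; have [/mx_wrtP mg /mx_wrtP mH _ _ _] := adapt k.
have {}mx := mxwrt_sub (@past_past' _ _ _ _ _ _ _ _ _ _ pr k : <<s past_gen pr k >> `<=` <<s past'_gen pr k >>) mx.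
have {}md := wrt_sub (@past_past' _ _ _ _ _ _ _ _ _ _ pr k : <<s past_gen pr k >> `<=` <<s past'_gen pr k >>) md.
rewrite (_ : [set w | _] =
  [set w | spec_norm (H k w - hess phi (x k w)) <= keh * delta k w + epsH] `&`
  [set w | enorm (g k w - grad phi (x k w)) <= keg * delta k w ^+ 2 + epsg]); last first.
  by apply/seteqP; split=> w /=; rewrite /accurate_at /accurate => /andP.
apply: (@measurableI _ (U' k)).
  apply: (@measurable_set_le _ (U' k)).
    apply: measurable_spec_norm; apply: mx_measurableB => //.
    exact: (mx_measurable_hess (S := U' k) phi2 mx).
  by apply: measurable_funD => //; exact: measurable_funM.
apply: (@measurable_set_le _ (U' k)).
  apply: measurable_enorm; apply: mx_measurableB => //.
  exact: (mx_measurable_grad (S := U' k) phi2 mx).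
by apply: measurable_funD => //; apply: measurable_funM => //; exact: measurable_funX.
Qed.

Lemma err_wrt k : wrt (past_gen pr k.+1) (err phi orc pr k) /\
  wrt (past_gen pr k.+1) (errplus phi orc pr k).
Proof.
have [mx _] := runM k; have [_ _ /mx_wrtP ms /rv_wrtP mf /rv_wrtP mfp] := adapt k.
have up0 : <<s past_gen pr k >> `<=` <<s past_gen pr k.+1 >> := past_sub (leqnSn k).
have up : <<s past'_gen pr k >> `<=` <<s past_gen pr k.+1 >> := @past'_past _ _ _ _ _ _ _ _ _ _ pr k.
have {}mx := mxwrt_sub up0 mx; have {}ms := mxwrt_sub up ms.
have mxs := mx_measurableD (S := U k.+1) mx ms.
split; (apply: measurableT_comp => //; apply: measurable_funB => //).
  exact: (measurable_phi (S := U k.+1) phi2 mx).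
exact: (measurable_phi (S := U k.+1) phi2 mxs).
Qed.

(** The symmetry of the Hessian enters here, through its smallest eigenvalue. *)
Lemma beta_measurable k :
  measurable_fun setT (fun w => beta L2 keg keh eta1 eta2 kfod kbhm phi epsg epsH (x k w)).
Proof.
have [mx _] := runM k; have sub := @past_measurable _ _ _ _ _ _ _ _ _ _ pr k.
have {}mx : mx_measurable (x k) by move=> i j _ B mB; apply: sub; exact: mx.
apply: measurable_maxr; apply: measurable_funB => //; apply: measurable_funM => //.
  by apply: measurable_enorm; exact: (mx_measurable_grad phi2 mx).
apply: measurable_lambda_min => //; last exact: (mx_measurable_hess phi2 mx).
by move=> w; exact: (hess_sym n_gt0 phi2 lipH).
Qed.

End Events.

(** * Concentration along the run *)

Section RunConcentration.
Context {R : realType} {n : nat} {d d0 d1 d2 : measure_display}.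
Context {T : measurableType d} {Xi0 : measurableType d0}
        {Xi1 : measurableType d1} {Xi2 : measurableType d2}.
Variables (P : probability T R) (phi : 'rV[R]_n -> R) (L2 epsf a epsg keg epsH keh : R).
Variables (orc : oracles R n Xi0 Xi1 Xi2) (pr : process R n T Xi0 Xi1 Xi2).
Variables (p1 p2 : R) (x0 : 'rV[R]_n) (delta0 eta1 eta2 gamma r kfod kbhm : R).
Hypotheses (n_gt0 : (0 < n)%N) (kfod_gt0 : 0 < kfod) (delta0_gt0 : 0 < delta0)
  (gamma_gt0 : 0 < gamma).
Hypotheses (phi2 : twice_cont_diff phi) (lipH : lipschitz_hessian phi L2).
Hypothesis run : runs_algorithm2 phi orc pr x0 delta0 eta1 eta2 gamma r p1 p2 kfod.
Hypothesis adapt : adapted orc pr p1 p2.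
Hypothesis noise_tail : zeroth_guarantee P phi orc pr epsf a.
Hypothesis model_acc : first_second_guarantee P phi orc pr epsg keg epsH keh p1 p2.
Hypotheses (epsf_ge0 : 0 <= epsf) (a_gt0 : 0 < a).
Hypothesis relaxation : 2 * epsf + epsg `^ (3 / 2) <= r.

Local Notation acc_at := (accurate_at phi epsg keg epsH keh orc pr p1 p2).
Local Notation low_at := (low_noise_at phi epsg orc pr r).
Local Notation E := (err phi orc pr).
Local Notation E' := (errplus phi orc pr).

Let accM := accurate_measurable epsg keg epsH keh n_gt0 kfod_gt0 delta0_gt0 gamma_gt0
  phi2 run adapt.
Let errM := err_wrt n_gt0 kfod_gt0 delta0_gt0 gamma_gt0 phi2 run adapt.

Lemma past'_gen_measurable k : <<s past'_gen pr k >> `<=` measurable.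
Proof. exact: (@past'_measurable _ _ _ _ _ _ _ _ _ _ pr k). Qed.

Lemma past'_later j k : (j < k)%N -> past' pr j `<=` past pr k.
Proof.
move=> jk; apply: (subset_trans (@past'_past _ _ _ _ _ _ _ _ _ _ pr j)).
exact: past_sub.
Qed.

Lemma past_later j k : (j < k)%N -> past pr j.+1 `<=` past' pr k.
Proof.
by move=> jk; apply: subset_trans (past_sub jk) (@past_past' _ _ _ _ _ _ _ _ _ _ pr k).
Qed.

Lemma err_measurable k : measurable_fun setT (E k) /\ measurable_fun setT (E' k).
Proof.
have [mE mE'] := errM k; have sub := @past_measurable _ _ _ _ _ _ _ _ _ _ pr k.+1.
by split=> _ B mB; apply: sub; [exact: mE|exact: mE'].
Qed.

Lemma err_later j k : (j < k)%N -> wrt (past'_gen pr k) (E j) /\ wrt (past'_gen pr k) (E' j).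
Proof.
have [mE mE'] := errM j => /past_later sub.
by split; [exact: wrt_sub sub mE|exact: wrt_sub sub mE'].
Qed.

Lemma err_tail k (t : R) B : 0 <= t -> <<s past'_gen pr k >> B ->
  (P ([set w | (t < E k w)%R] `&` B) <= (expR (a * (epsf - t)))%:E * P B)%E /\
  (P ([set w | (t < E' k w)%R] `&` B) <= (expR (a * (epsf - t)))%:E * P B)%E.
Proof.
move=> t0 GB; have [h h'] := noise_tail k t0; have sG := @past'_gen_measurable k.
by split; [exact: (cond_prob_leP sG h)|exact: (cond_prob_leP sG h')].
Qed.

Lemma accurate_count (phat : R) (N : nat) : 2^-1 <= p1 * p2 <= 1 -> phat <= p1 * p2 ->
  (P [set w | ((\sum_(k < N) acc_at k w)%N%:R <= phat * N%:R)%R]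
    <= (expR (- ((1 - phat / (p1 * p2)) ^+ 2 / 2 * N%:R)))%:E)%E.
Proof.
move=> p_bounds php; have sG k := @past_measurable _ _ _ _ _ _ _ _ _ _ pr k.
apply: (count_concentration (G := past_gen pr)) => // [k|j k jk|k].
- exact: (past'_gen_measurable (@accM k)).
- exact: (past'_later jk (@accM j)).
apply: (cond_prob_compl (sG k) (past'_gen_measurable (@accM k))).
have := cond_prob_geP (sG k) (model_acc k).
rewrite (_ : [set w | _ /\ _] = [set w | acc_at k w])//.
by apply/seteqP; split=> w /=; rewrite /accurate_at /accurate => /andP.
Qed.

Local Notation p0 := (1 - 2 * expR (a / 2 * (2 * epsf + epsg `^ (3 / 2) - r))).

(** If the two errors sum to more than the relaxation allows, then one of them
   exceeds half of it, which is at least [epsf]. *)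
Lemma high_noise_le k B : <<s past'_gen pr k >> B ->
  (P (~` [set w | low_at k w] `&` B) <= (1 - p0)%:E * P B)%E.
Proof.
move=> GB; have mB := @past'_gen_measurable k _ GB.
pose q := (r - epsg `^ (3 / 2)) / 2.
have q_ge : epsf <= q by rewrite /q ler_pdivlMr//; move: relaxation; lra.
have [t1 t2] := err_tail (le_trans epsf_ge0 q_ge) GB.
have [mE mE'] := err_measurable k.
have mS (F : T -> R) : measurable_fun setT F -> measurable ([set w | (q < F w)%R] `&` B).
  by move=> mF; apply: measurableI => //; apply: measurable_set_lt => //; exact: measurable_cst.
have eq_exp : expR (a / 2 * (2 * epsf + epsg `^ (3 / 2) - r)) = expR (a * (epsf - q)).
  by congr expR; rewrite /q; field.
apply: (@le_trans _ _ (P (([set w | (q < E k w)%R] `&` B) `|` ([set w | (q < E' k w)%R] `&` B)))).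
  apply: le_measure; rewrite ?inE.
  - apply: measurableI => //; apply: measurableC.
    by apply: measurable_set_le => //; exact: measurable_funD.
  - by apply: measurableU; exact: mS.
  - move=> w [/= hi Bw]; have [Eq|qE] := leP (E k w) q; last by left.
    right; split=> //=; rewrite ltNge; apply/negP => E'q; apply: hi.
    rewrite /low_noise_at /low_noise; have := lerD Eq E'q; rewrite /q.
    by rewrite -splitr.
apply: le_trans (measureU2 _ _ _) _; [exact: mS|exact: mS|].
apply: le_trans (leeD t1 t2) _.
rewrite -ge0_muleDl ?lee_fin ?expR_ge0// -EFinD eq_exp lee_wpmul2r// lee_fin; lra.
Qed.

Lemma low_noise_count (phat : R) (N : nat) : 2^-1 <= p0 -> phat <= p0 ->
  (P [set w | ((\sum_(k < N) low_at k w)%N%:R <= phat * N%:R)%R]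
    <= (expR (- ((1 - phat / p0) ^+ 2 / 2 * N%:R)))%:E)%E.
Proof.
move=> p_ge php; apply: (count_concentration (G := past'_gen pr)) => // [k|k|j k jk|k B|].
- exact: past'_gen_measurable.
- by have [mE mE'] := err_measurable k; apply: measurable_set_le => //; exact: measurable_funD.
- have [mE mE'] := err_later jk.
  apply: (@measurable_set_le _ (g_sigma_algebraType (past'_gen pr k))) => //.
  exact: measurable_funD.
- exact: high_noise_le.
- by rewrite p_ge; have := expR_ge0 (a / 2 * (2 * epsf + epsg `^ (3 / 2) - r)); lra.
Qed.

Lemma noise_sum (t : R) (N : nat) :
  (P [set w | (N%:R * (2 * epsf + 4 / a) + t <= \sum_(k < N) (E k w + E' k w))%R]
    <= (expR (- (a / 4 * t)))%:E)%E.
Proof.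
apply: (noise_concentration (G := past'_gen pr)) => // [k|k|k|j k jk|j k jk|k s s0 B GB|k s s0 B GB].
- exact: past'_gen_measurable.
- by have [] := err_measurable k.
- by have [] := err_measurable k.
- by have [] := err_later jk.
- by have [] := err_later jk.
- by have [] := err_tail s0 GB.
- by have [] := err_tail s0 GB.
Qed.

End RunConcentration.

(** * The complexity bound *)

(** The two entries of the minimum bound the two signs of the initial level, the
   second one because the optimality measure [b] at the start exceeds [e]. *)
Lemma abs_level_le (R : realType) (gamma e z b : R) :
  0 < gamma -> gamma < 1 -> 0 < e -> 0 < z -> e < b ->
  `|ln (z / e) / - ln gamma| <= log_base gamma (Num.min (e / z) (z / b)).
Proof.
move=> g0 g1 e0 z0 eb; have b0 := lt_trans e0 eb.
have l0 : 0 < - ln gamma by rewrite oppr_gt0 ln_lt0// g0.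
have ez0 : 0 < e / z by rewrite divr_gt0.
have zb0 : 0 < z / b by rewrite divr_gt0.
rewrite /log_base; set y := Num.min _ _.
have y0 : 0 < y by rewrite lt_min ez0 zb0.
have lnez : ln (e / z) = - ln (z / e) by rewrite -lnV ?posrE ?divr_gt0// invf_div.
have h1 : ln y <= - ln (z / e) by rewrite -lnez ler_ln ?posrE// ge_min lexx.
have h2 : ln y <= ln (z / e).
  rewrite ler_ln ?posrE ?divr_gt0// ge_min; apply/orP; right.
  by rewrite ler_pM2l// lef_pV2 ?posrE// ltW.
have -> : ln y / ln gamma = (- ln y) / - ln gamma by rewrite invrN mulrNN.
by rewrite ler_norml -mulNr !ler_pM2r ?invr_gt0//; apply/andP; split; lra.
Qed.

Lemma measurable_bigmin (d : measure_display) (S : measurableType d) (R : realType)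
    (N : nat) (F : 'I_N -> S -> R) (f0 : S -> R) :
  measurable_fun setT f0 -> (forall k, measurable_fun setT (F k)) ->
  measurable_fun setT (fun w => \big[Num.min/f0 w]_(k < N) F k w).
Proof.
move=> mf0 mF; elim: (index_enum _) => [|k r IH].
  by under eq_fun do rewrite big_nil.
by under eq_fun do rewrite big_cons; exact: measurable_minr.
Qed.

Theorem theorem5p10 (R : realType) (n : nat) (d d0 d1 d2 : measure_display)
    (T : measurableType d) (Xi0 : measurableType d0)
    (Xi1 : measurableType d1) (Xi2 : measurableType d2)
    (P : probability T R) (phi : 'rV[R]_n -> R) (L2 phihat : R)
    (epsf a epsg keg epsH keh p1 p2 : R)
    (x0 : 'rV[R]_n) (delta0 eta1 eta2 gamma r kfod kbhm : R)
    (orc : oracles R n Xi0 Xi1 Xi2) (pr : process R n T Xi0 Xi1 Xi2)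
    (eps' p0hat p12hat t : R) (N : nat) :
  (0 < n)%N ->
  twice_cont_diff phi ->
  lipschitz_hessian phi L2 ->
  (forall x, phihat <= phi x) ->
  0 <= epsf -> 0 < a ->
  0 <= epsg -> 0 <= keg -> 0 <= epsH -> 0 <= keh ->
  2^-1 <= p1 <= 1 -> 2^-1 <= p2 <= 1 ->
  0 < delta0 -> 0 < eta1 < 1 -> 0 < eta2 -> 0 < gamma < 1 -> 0 < r ->
  0 < kfod <= 1 -> 0 < kbhm ->
  runs_algorithm2 phi orc pr x0 delta0 eta1 eta2 gamma r p1 p2 kfod ->
  adapted orc pr p1 p2 ->
  zeroth_guarantee P phi orc pr epsf a ->
  first_second_guarantee P phi orc pr epsg keg epsH keh p1 p2 ->
  (forall k w, spec_norm (Hk orc pr p2 k w) <= kbhm) ->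
  2 * epsf + epsg `^ (3 / 2) <= r ->
  eps' <= 1 -> epsg <= 1 -> epsH <= 1 ->
  let p12 := p1 * p2 in
  let p0 := 1 - 2 * expR (a / 2 * (2 * epsf + epsg `^ (3 / 2) - r)) in
  let C8 := C8 eta1 eta2 kfod kbhm in
  let beta := beta L2 keg keh eta1 eta2 kfod kbhm phi epsg epsH in
  let descent := C8 * (gamma * eps') ^+ 3 in
  let threshold := 3 / 2 + (2 * epsf + 4 / a + r) / descent in
  ((4 * epsf + 8 / a + 2 * r) / (C8 * gamma ^+ 3 * (2 * p0 + 2 * p12 - 3)))
    `^ (3^-1) < eps' ->
  threshold < p0hat + p12hat <= p0 + p12 ->
  p0hat <= p0 -> p12hat <= p12 ->
  0 <= t ->
  (0 < N)%N ->
  (p0hat + p12hat - threshold)^-1 *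
    ((phi x0 - phihat + t) / descent
     + 2^-1 * log_base gamma (Num.min (eps' / delta0) (delta0 / beta x0))
     + 2^-1) <= N%:R ->
  ((1 - expR (- ((1 - p12hat / p12) ^+ 2 / 2 * N%:R))
      - expR (- ((1 - p0hat / p0) ^+ 2 / 2 * N%:R))
      - expR (- (a / 4 * t)))%:E
   <= P [set w | (\big[Num.min/beta (iterate pr 0 w)]_(k < N) beta (iterate pr k w) <= eps')%R])%E.
Proof.
move=> n0 phi2 lipH lb ef0 a0 eg0 keg0 eH0 keh0 /andP[p1l p1u] /andP[p2l p2u].
move=> dl0 /andP[e1pos e1lt] e2pos /andP[gpos glt] rpos /andP[kf0 _] kb0.
move=> run adapt noise model Hle relax eps1 _ eH1 p12 p0 C8' bet descent thr.
move=> heps /andP[thr_lt ph_le] p0h p12h _ Npos Nge.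
have eps0 : 0 < eps' := le_lt_trans (powR_ge0 _ _) heps.
have C8_gt0 : 0 < C8'.
  by rewrite /C8' /C8 !mulr_gt0 ?invr_gt0// lt_min ltr01 andbT divr_gt0.
have D0 : 0 < descent by rewrite mulr_gt0// exprn_gt0// mulr_gt0.
have frac0 : 0 <= (2 * epsf + 4 / a + r) / descent.
  have a4 : 0 <= 4 / a by rewrite divr_ge0// ltW.
  by rewrite divr_ge0 ?(ltW D0)//; lra.
have p12_le1 : p12 <= 1 by rewrite mulr_ile1//; [move: p1l|move: p2l]; lra.
have p0_le1 : p0 <= 1.
  by rewrite lerBlDr lerDl mulr_ge0// expR_ge0.
have sum_gt : 3 / 2 < p0 + p12 by move: thr_lt ph_le; rewrite /thr; lra.
have p12_ge : 2^-1 <= p12 by lra.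
have p0_ge : 2^-1 <= p0 by lra.
have [xinit dinit step] := run.
pose Bmodel := [set w | ((\sum_(k < N) accurate_at phi epsg keg epsH keh orc pr p1 p2 k w)%N%:R
  <= p12hat * N%:R)%R].
pose Bnoise := [set w | ((\sum_(k < N) low_noise_at phi epsg orc pr r k w)%N%:R <= p0hat * N%:R)%R].
pose Bsum := [set w | (N%:R * (2 * epsf + 4 / a) + t <=
  \sum_(k < N) (err phi orc pr k w + errplus phi orc pr k w))%R].
have PBmodel : (P Bmodel <= (expR (- ((1 - p12hat / p12) ^+ 2 / 2 * N%:R)))%:E)%E.
  apply: (accurate_count n0 kf0 dl0 gpos phi2 run adapt model) => //.
  by rewrite p12_ge.
have PBnoise : (P Bnoise <= (expR (- ((1 - p0hat / p0) ^+ 2 / 2 * N%:R)))%:E)%E.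
  exact: (low_noise_count n0 kf0 dl0 gpos phi2 run adapt noise ef0 relax).
have PBsum : (P Bsum <= (expR (- (a / 4 * t)))%:E)%E.
  exact: (noise_sum n0 kf0 dl0 gpos phi2 run adapt noise ef0 a0).
set target := [set w | _].
(* Off the three exceptional events the measure cannot stay above [eps']. *)
have cover : [set: T] `<=` target `|` Bmodel `|` Bnoise `|` Bsum.
  move=> w _; have [Sw|Sw] := pselect (target w); first by left; left; left.
  have [|I_gt] := leP (\sum_(k < N) accurate_at phi epsg keg epsH keh orc pr p1 p2 k w)%N%:R
    (p12hat * N%:R); first by left; left; right.
  have [|J_gt] := leP (\sum_(k < N) low_noise_at phi epsg orc pr r k w)%N%:R
    (p0hat * N%:R); first by left; right.
  have [|E_lt] := leP (N%:R * (2 * epsf + 4 / a) + t)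
    (\sum_(k < N) (err phi orc pr k w + errplus phi orc pr k w)); first by right.
  exfalso; move: Sw => /negP; rewrite /= -ltNge => /bigmin_gtP[beta0 betak].
  have beta_x0 : eps' < bet x0 by rewrite -(xinit w).
  have bound : descent * ((\sum_(k < N) accurate_at phi epsg keg epsH keh orc pr p1 p2 k w)%N%:R
      + (\sum_(k < N) low_noise_at phi epsg orc pr r k w)%N%:R
      - (3 / 2 * N%:R + 2^-1 * `|ln (delta0 / eps') / - ln gamma| + 2^-1)) <=
      phi x0 - phihat + N%:R * r +
      \sum_(k < N) (err phi orc pr k w + errplus phi orc pr k w).
    rewrite -(dinit w) -(xinit w).
    apply: (@trajectory_bound R n phi L2 epsg keg epsH keh eta1 eta2 gamma kfod kbhm r
      n0 phi2 lipH eg0 keg0 eH0 keh0 eH1 e1pos e1lt e2pos gpos glt kf0 kb0 rpos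
      (iterate pr ^~ w) (Gk orc pr p1 ^~ w) (trial_step pr ^~ w) (Hk orc pr p2 ^~ w)
      (Defs.radius pr ^~ w) (Fk orc pr ^~ w) (Fplus orc pr ^~ w)) => //.
    - by move=> k; exact: second_sym.
    - by rewrite dinit.
    - by move=> k; have [] := step k w.
    - by move=> k; have [] := step k w.
    - by move=> k; have [] := step k w.
    - by move=> k kN; exact: (betak (Ordinal kN)).
  have level0 := abs_level_le gpos glt eps0 dl0 beta_x0.
  have gap0 : 0 < p0hat + p12hat - thr by rewrite subr_gt0.
  move: Nge; rewrite mulrC ler_pdivrMr// => Nge.
  have {}Nge := ler_wpM2l (ltW D0) Nge.
  have Dn0 : descent != 0 by rewrite gt_eqF.
  move: level0 bound I_gt J_gt E_lt Nge; rewrite /thr.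
  move: (log_base _ _) (\sum_(k < N) accurate_at _ _ _ _ _ _ _ _ _ _ _)%N%:R
    (\sum_(k < N) low_noise_at _ _ _ _ _ _ _)%N%:R (\sum_(k < N) (_ + _)) `|_|
    => M I J E l lM bound I_gt J_gt E_lt.
  have -> : descent * ((phi x0 - phihat + t) / descent + 2^-1 * M + 2^-1) =
    phi x0 - phihat + t + descent * (2^-1 * M + 2^-1) by field.
  have -> : descent * (N%:R * (p0hat + p12hat - (3 / 2 + (2 * epsf + 4 / a + r) / descent))) =
    descent * (N%:R * (p0hat + p12hat - 3 / 2)) - N%:R * (2 * epsf + 4 / a + r).
    by field; rewrite Dn0 gt_eqF.
  have : descent * (N%:R * (p0hat + p12hat - 3 / 2) - (2^-1 * M + 2^-1)) <
      descent * (I + J - (3 / 2 * N%:R + 2^-1 * l + 2^-1)).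
    by rewrite ltr_pM2l//; lra.
  lra.
have mtarget : measurable target.
  apply: measurable_set_le => //; apply: measurable_bigmin => [|k];
  exact: (beta_measurable epsg keg epsH keh kbhm n0 kf0 dl0 gpos phi2 lipH run adapt).
have [mB1 mB2 mB3] : [/\ measurable Bmodel, measurable Bnoise & measurable Bsum].
  have mE k := err_measurable n0 kf0 dl0 gpos phi2 run adapt k.
  split; apply: measurable_set_le => //; try exact: measurable_count.
  - apply: measurable_count => k; apply: (@past'_measurable _ _ _ _ _ _ _ _ _ _ pr k).
    exact: (accurate_measurable _ _ _ _ n0 kf0 dl0 gpos phi2 run adapt).
  - apply: measurable_count => k; have [mEk mE'k] := mE k.
    by apply: measurable_set_le => //; exact: measurable_funD.
  - by apply: measurable_sum => k; have [mEk mE'k] := mE k; exact: measurable_funD.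
have mU1 := measurableU _ _ mtarget mB1; have mU2 := measurableU _ _ mU1 mB2.
have : (1 <= P target + P Bmodel + P Bnoise + P Bsum)%E.
  rewrite -(@probability_setT _ _ _ P).
  apply: le_trans (le_measure _ _ _ cover) _; rewrite ?inE//; first exact: measurableU.
  apply: le_trans (measureU2 _ mU2 mB3) _; rewrite leeD2r//.
  apply: le_trans (measureU2 _ mU1 mB2) _; rewrite leeD2r//.
  exact: (measureU2 _ mtarget mB1).
move=> /le_trans/(_ (leeD (leeD (leeD (lexx _) PBmodel) PBnoise) PBsum)).
rewrite -(fineK (fin_num_measure P _ mtarget)) -!EFinD !lee_fin.
lra.
Qed.
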